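(* Let $G$ be a finite group and let $F\colon\mathcal C\to\mathcal D$ be a $G$-functor between small categories with $G$-action. If $F$ is $G$-homotopy initial or $G$-homotopy final, then $|F|\colon|\mathcal C|\to|\mathcal D|$ is a $G$-homotopy equivalence.
   Context: A category with $G$-action is a small category $\mathcal D$ with functors $(g\cdot)\colon\mathcal D\to\mathcal D$ for $g\in G$ satisfying $(e\cdot)=\mathrm{id}$ and $(g\cdot)\circ(g'\cdot)=(gg'\cdot)$ strictly. A $G$-functor is a functor strictly commuting with the actions on objects and morphisms. $|\mathcal C|$ is the classifying space (geometric realization of the nerve) with induced $G$-action. A $G$-map is a $G$-homotopy equivalence if it restricts to a homotopy equivalence on $H$-fixed points for every $H\le G$. For an object $d$ of $\mathcal D$, $G_d=\{g\in G\mid g\cdot d=d\}$; the overcategory $F\downarrow d$ (objects $(c,Fc\to d)$) and undercategory $d\downarrow F$ (objects $(c,d\to Fc)$) inherit $G_d$-actions. A category $\mathcal E$ with $K$-action is $K$-contractible if $|\mathcal E|^{H}$ is contractible for every $H\le K$. $F$ is $G$-homotopy initial (resp. $G$-homotopy final) if $F\downarrow d$ (resp. $d\downarrow F$) is $G_d$-contractible for every object $d$ of $\mathcal D$. *)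

(* Defs.v *)
From Stdlib Require Import Relations.
From HB Require Import structures.
From mathcomp Require Import all_boot all_order all_algebra all_fingroup.
From mathcomp Require Import generic_quotient.
From mathcomp Require Import all_classical all_reals topology normedtype.

Set Implicit Arguments.
Unset Strict Implicit.
Unset Printing Implicit Defensive.

Import Order.TTheory GRing.Theory Num.Theory.
Import numFieldNormedType.Exports.

Local Open Scope classical_set_scope.
Local Open Scope ring_scope.
Local Open Scope quotient_scope.

Local Obligation Tactic := idtac.

(* A small category is given by a type of objects and a single type of arrows *)
(* with domain and codomain, so that strict equality of functors (hence the   *)
(* strict laws of a group action) is plain equality, without transport along  *)
(* equalities of objects. [mcomp g f _] is "g after f". In the laws below,    *)
(* the composability proofs are universally quantified; all of them follow    *)
(* from those for the left-hand side.                                         *)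
Record category := Category {
  ob : Type;
  mor : Type;
  dom : mor -> ob;
  cod : mor -> ob;
  idm : ob -> mor;
  mcomp : forall g f : mor, dom g = cod f -> mor;
  dom_idm : forall x, dom (idm x) = x;
  cod_idm : forall x, cod (idm x) = x;
  dom_mcomp : forall g f e, dom (@mcomp g f e) = dom f;
  cod_mcomp : forall g f e, cod (@mcomp g f e) = cod g;
  mcomp_idl : forall f e, @mcomp (idm (cod f)) f e = f;
  mcomp_idr : forall f e, @mcomp f (idm (dom f)) e = f;
  mcompA : forall h g f e1 e2 e3 e4,
    @mcomp h (@mcomp g f e1) e2 = @mcomp (@mcomp h g e3) f e4 }.

Arguments mcomp {c} g f e.

Record functor (C D : category) := Functor {
  fob :> ob C -> ob D;
  fmor : mor C -> mor D;
  fdom : forall f, dom (fmor f) = fob (dom f);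
  fcod : forall f, cod (fmor f) = fob (cod f);
  fidm : forall x, fmor (idm x) = idm (fob x);
  fcomp : forall g f e e', fmor (mcomp g f e) = mcomp (fmor g) (fmor f) e' }.

Lemma eq_functor (C D : category) (F F' : functor C D) :
  (forall x, F x = F' x) -> (forall f, fmor F f = fmor F' f) -> F = F'.
Proof.
case: F F' => [o m p1 p2 p3 p4] [o' m' q1 q2 q3 q4] /= /funext eo /funext em.
move: p1 p2 p3 p4 q1 q2 q3 q4; rewrite eo em => *.
by congr Functor; exact: Prop_irrelevance.
Qed.

Lemma eq_comp (C : category) (g f g' f' : mor C) e e' :
  g = g' -> f = f' -> mcomp g f e = mcomp g' f' e'.
Proof. by move=> eg ef; subst; congr mcomp; exact: Prop_irrelevance. Qed.

Definition functor_id (C : category) : functor C C :=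
  @Functor C C id id (fun=> erefl) (fun=> erefl) (fun=> erefl)
    (fun g f e e' => eq_comp e e' erefl erefl).

Program Definition functor_comp (A B C : category)
    (F : functor B C) (E : functor A B) : functor A C :=
  @Functor A C (fun x => F (E x)) (fun f => fmor F (fmor E f)) _ _ _ _.
Next Obligation. by move=> A B C F E f; rewrite !fdom. Qed.
Next Obligation. by move=> A B C F E f; rewrite !fcod. Qed.
Next Obligation. by move=> A B C F E x /=; rewrite !fidm. Qed.
Next Obligation.
move=> A B C F E g f e e' /=.
have e1 : dom (fmor E g) = cod (fmor E f) by rewrite fdom fcod e.
by rewrite (fcomp _ e1) (fcomp _ e').
Qed.

Record cat_action (gT : finGroupType) (C : category) := CatAction {
  act_functor :> gT -> functor C C;
  act_functor1 : act_functor 1%g = functor_id C;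
  act_functorM : forall g h : gT,
    act_functor (g * h)%g = functor_comp (act_functor g) (act_functor h) }.

Lemma act1E (gT : finGroupType) (C : category) (a : cat_action gT C) :
  (forall x, a 1%g x = x) /\ (forall f, fmor (a 1%g) f = f).
Proof. by rewrite act_functor1. Qed.

Lemma actME (gT : finGroupType) (C : category) (a : cat_action gT C)
  (g h : gT) :
  (forall x, a (g * h)%g x = a g (a h x)) /\
  (forall f, fmor (a (g * h)%g) f = fmor (a g) (fmor (a h) f)).
Proof. by rewrite act_functorM. Qed.

Definition is_Gfunctor (gT : finGroupType) (C D : category)
    (aC : cat_action gT C) (aD : cat_action gT D) (F : functor C D) : Prop :=
  (forall g x, F (aC g x) = aD g (F x)) /\
  (forall g f, fmor F (fmor (aC g) f) = fmor (aD g) (fmor F f)).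

Definition stab_set (gT : finGroupType) (C : category) (a : cat_action gT C)
  (d : ob C) : {set gT} := [set g | `[< a g d = d >]]%SET.

Lemma stab_setP (gT : finGroupType) (C : category) (a : cat_action gT C)
  (d : ob C) (g : gT) : reflect (a g d = d) (g \in stab_set a d).
Proof. by rewrite finset.inE; exact: asboolP. Qed.

Lemma stab_group_set (gT : finGroupType) (C : category) (a : cat_action gT C)
  (d : ob C) : group_set (stab_set a d).
Proof.
apply/group_setP; split=> [|g h].
  by apply/stab_setP; rewrite act_functor1.
move=> /stab_setP gd /stab_setP hd; apply/stab_setP.
by rewrite act_functorM /= hd gd.
Qed.

Definition stab (gT : finGroupType) (C : category) (a : cat_action gT C)
  (d : ob C) : {group gT} := Group (stab_group_set a d).

Lemma stab_fix (gT : finGroupType) (C : category) (a : cat_action gT C)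
  (d : ob C) (k : subg_of (stab a d)) : a (sgval k) d = d.
Proof. exact/stab_setP/subgP. Qed.

Record over_ob (C D : category) (F : functor C D) (d : ob D) := OverOb {
  ov_ob : ob C;
  ov_map : mor D;
  ov_dom : dom ov_map = F ov_ob;
  ov_cod : cod ov_map = d }.

Record over_mor (C D : category) (F : functor C D) (d : ob D) := OverMor {
  ov_src : over_ob F d;
  ov_tgt : over_ob F d;
  ov_mor : mor C;
  ov_mor_dom : dom ov_mor = ov_ob ov_src;
  ov_mor_cod : cod ov_mor = ov_ob ov_tgt;
  ov_mor_eq : exists e,
    mcomp (ov_map ov_tgt) (fmor F ov_mor) e = ov_map ov_src }.

Lemma over_ob_eq (C D : category) (F : functor C D) (d : ob D)
  (x y : over_ob F d) : ov_ob x = ov_ob y -> ov_map x = ov_map y -> x = y.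
Proof.
case: x y => [c u p q] [c' u' p' q'] /= ec eu; subst.
by congr OverOb; exact: Prop_irrelevance.
Qed.

Lemma over_mor_eq (C D : category) (F : functor C D) (d : ob D)
  (x y : over_mor F d) : ov_src x = ov_src y -> ov_tgt x = ov_tgt y ->
  ov_mor x = ov_mor y -> x = y.
Proof.
case: x y => [s t h p q r] [s' t' h' p' q' r'] /= es et eh; subst.
by congr OverMor; exact: Prop_irrelevance.
Qed.

Program Definition overcat (C D : category) (F : functor C D) (d : ob D) :
    category :=
  @Category (over_ob F d) (over_mor F d) (@ov_src C D F d) (@ov_tgt C D F d)
    (fun x => @OverMor C D F d x x (idm (ov_ob x)) (dom_idm _) (cod_idm _) _)
    (fun g f e => @OverMor C D F d (ov_src f) (ov_tgt g)
       (mcomp (ov_mor g) (ov_mor f) _) _ _ _)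
    _ _ _ _ _ _ _.
Next Obligation.
move=> C D F d x.
have e : dom (ov_map x) = cod (fmor F (idm (ov_ob x))).
  by rewrite fidm cod_idm ov_dom.
have e' : dom (ov_map x) = cod (idm (dom (ov_map x))) by rewrite cod_idm.
exists e; rewrite -[RHS](mcomp_idr e'); apply: eq_comp => //.
by rewrite fidm ov_dom.
Qed.
Next Obligation. by move=> C D F d g f e; rewrite ov_mor_dom ov_mor_cod e. Qed.
Next Obligation. by move=> C D F d g f e; rewrite dom_mcomp ov_mor_dom. Qed.
Next Obligation. by move=> C D F d g f e; rewrite cod_mcomp ov_mor_cod. Qed.
Next Obligation.
move=> C D F d g f e.
have [eg Eg] := ov_mor_eq g; have [ef Ef] := ov_mor_eq f.
set k := overcat_obligation_2 _.
have e2 : dom (fmor F (ov_mor g)) = cod (fmor F (ov_mor f)).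
  by rewrite fdom fcod k.
have e5 : dom (ov_map (ov_tgt g)) =
    cod (mcomp (fmor F (ov_mor g)) (fmor F (ov_mor f)) e2).
  by rewrite cod_mcomp.
have e6 : dom (mcomp (ov_map (ov_tgt g)) (fmor F (ov_mor g)) eg) =
    cod (fmor F (ov_mor f)) by rewrite dom_mcomp.
have e7 : dom (ov_map (ov_tgt g)) =
    cod (fmor F (mcomp (ov_mor g) (ov_mor f) k)) by rewrite (fcomp k e2).
exists e7; rewrite -Ef; transitivity (mcomp _ _ e5).
  by apply: eq_comp => //; rewrite (fcomp k e2).
rewrite (mcompA e5 e6); apply: eq_comp => //.
by rewrite Eg e.
Qed.
Next Obligation. by []. Qed.
Next Obligation. by []. Qed.
Next Obligation. by []. Qed.
Next Obligation. by []. Qed.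
Next Obligation.
move=> C D F d f e; apply: over_mor_eq => //=.
have e' : dom (idm (cod (ov_mor f))) = cod (ov_mor f) by rewrite dom_idm.
by rewrite -[RHS](mcomp_idl e'); apply: eq_comp; rewrite ?ov_mor_cod.
Qed.
Next Obligation.
move=> C D F d f e; apply: over_mor_eq => //=.
have e' : dom (ov_mor f) = cod (idm (dom (ov_mor f))) by rewrite cod_idm.
by rewrite -[RHS](mcomp_idr e'); apply: eq_comp; rewrite ?ov_mor_dom.
Qed.
Next Obligation.
by move=> C D F d h g f e1 e2 e3 e4; apply: over_mor_eq => //=; exact: mcompA.
Qed.

Program Definition over_translate_ob (gT : finGroupType) (C D : category)
    (aC : cat_action gT C) (aD : cat_action gT D) (F : functor C D)
    (hF : is_Gfunctor aC aD F) (d : ob D) (g : gT) (gd : aD g d = d)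
    (x : over_ob F d) : over_ob F d :=
  @OverOb C D F d (aC g (ov_ob x)) (fmor (aD g) (ov_map x)) _ _.
Next Obligation.
by move=> gT C D aC aD F hF d g gd x; rewrite fdom ov_dom (proj1 hF).
Qed.
Next Obligation. by move=> gT C D aC aD F hF d g gd x; rewrite fcod ov_cod. Qed.

Program Definition over_translate_mor (gT : finGroupType) (C D : category)
    (aC : cat_action gT C) (aD : cat_action gT D) (F : functor C D)
    (hF : is_Gfunctor aC aD F) (d : ob D) (g : gT) (gd : aD g d = d)
    (h : over_mor F d) : over_mor F d :=
  @OverMor C D F d (over_translate_ob hF gd (ov_src h))
    (over_translate_ob hF gd (ov_tgt h)) (fmor (aC g) (ov_mor h)) _ _ _.
Next Obligation.
by move=> gT C D aC aD F hF d g gd h; rewrite fdom ov_mor_dom.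
Qed.
Next Obligation.
by move=> gT C D aC aD F hF d g gd h; rewrite fcod ov_mor_cod.
Qed.
Next Obligation.
move=> gT C D aC aD F hF d g gd h /=.
have [e E] := ov_mor_eq h.
have e1 : dom (fmor (aD g) (ov_map (ov_tgt h))) =
    cod (fmor (aD g) (fmor F (ov_mor h))) by rewrite fdom fcod e.
have e2 : dom (fmor (aD g) (ov_map (ov_tgt h))) =
    cod (fmor F (fmor (aC g) (ov_mor h))) by rewrite e1 (proj2 hF).
exists e2; rewrite -E (fcomp e e1); apply: eq_comp => //.
exact: (proj2 hF).
Qed.

Program Definition over_translate (gT : finGroupType) (C D : category)
    (aC : cat_action gT C) (aD : cat_action gT D) (F : functor C D)
    (hF : is_Gfunctor aC aD F) (d : ob D) (g : gT) (gd : aD g d = d) :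
    functor (overcat F d) (overcat F d) :=
  @Functor (overcat F d) (overcat F d) (over_translate_ob hF gd)
    (over_translate_mor hF gd) (fun=> erefl) (fun=> erefl) _ _.
Next Obligation.
by move=> gT C D aC aD F hF d g gd x; apply: over_mor_eq => //=; rewrite fidm.
Qed.
Next Obligation.
move=> gT C D aC aD F hF d g gd k h e e'; apply: over_mor_eq => //=.
exact: fcomp.
Qed.

Program Definition over_action (gT : finGroupType) (C D : category)
    (aC : cat_action gT C) (aD : cat_action gT D) (F : functor C D)
    (hF : is_Gfunctor aC aD F) (d : ob D) :
    cat_action (subg_of (stab aD d)) (overcat F d) :=
  @CatAction _ (overcat F d) (fun k => over_translate hF (stab_fix k)) _ _.
Next Obligation.
move=> gT C D aC aD F hF d.
have obE (x : over_ob F d) :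
    over_translate hF (stab_fix (1%g : subg_of (stab aD d))) x = x.
  by apply: over_ob_eq => /=; apply act1E.
apply: eq_functor => // f; apply: over_mor_eq; try exact: obE.
by apply act1E.
Qed.
Next Obligation.
move=> gT C D aC aD F hF d g h.
have obE (x : over_ob F d) : over_translate hF (stab_fix (g * h)%g) x =
    over_translate hF (stab_fix g) (over_translate hF (stab_fix h) x).
  by apply: over_ob_eq => /=; apply actME.
apply: eq_functor => // f; apply: over_mor_eq; try exact: obE.
by apply actME.
Qed.

Record under_ob (C D : category) (F : functor C D) (d : ob D) := UnderOb {
  un_ob : ob C;
  un_map : mor D;
  un_dom : dom un_map = d;
  un_cod : cod un_map = F un_ob }.

Record under_mor (C D : category) (F : functor C D) (d : ob D) := UnderMor {
  un_src : under_ob F d;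
  un_tgt : under_ob F d;
  un_mor : mor C;
  un_mor_dom : dom un_mor = un_ob un_src;
  un_mor_cod : cod un_mor = un_ob un_tgt;
  un_mor_eq : exists e,
    mcomp (fmor F un_mor) (un_map un_src) e = un_map un_tgt }.

Lemma under_ob_eq (C D : category) (F : functor C D) (d : ob D)
  (x y : under_ob F d) : un_ob x = un_ob y -> un_map x = un_map y -> x = y.
Proof.
case: x y => [c u p q] [c' u' p' q'] /= ec eu; subst.
by congr UnderOb; exact: Prop_irrelevance.
Qed.

Lemma under_mor_eq (C D : category) (F : functor C D) (d : ob D)
  (x y : under_mor F d) : un_src x = un_src y -> un_tgt x = un_tgt y ->
  un_mor x = un_mor y -> x = y.
Proof.
case: x y => [s t h p q r] [s' t' h' p' q' r'] /= es et eh; subst.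
by congr UnderMor; exact: Prop_irrelevance.
Qed.

Program Definition undercat (C D : category) (F : functor C D) (d : ob D) :
    category :=
  @Category (under_ob F d) (under_mor F d) (@un_src C D F d) (@un_tgt C D F d)
    (fun x => @UnderMor C D F d x x (idm (un_ob x)) (dom_idm _) (cod_idm _) _)
    (fun g f e => @UnderMor C D F d (un_src f) (un_tgt g)
       (mcomp (un_mor g) (un_mor f) _) _ _ _)
    _ _ _ _ _ _ _.
Next Obligation.
move=> C D F d x.
have e : dom (fmor F (idm (un_ob x))) = cod (un_map x).
  by rewrite fidm dom_idm un_cod.
have e' : dom (idm (cod (un_map x))) = cod (un_map x) by rewrite dom_idm.
exists e; rewrite -[RHS](mcomp_idl e'); apply: eq_comp => //.
by rewrite fidm un_cod.
Qed.
Next Obligation. by move=> C D F d g f e; rewrite un_mor_dom un_mor_cod e. Qed.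
Next Obligation. by move=> C D F d g f e; rewrite dom_mcomp un_mor_dom. Qed.
Next Obligation. by move=> C D F d g f e; rewrite cod_mcomp un_mor_cod. Qed.
Next Obligation.
move=> C D F d g f e.
have [eg Eg] := un_mor_eq g; have [ef Ef] := un_mor_eq f.
set k := undercat_obligation_2 _.
have e2 : dom (fmor F (un_mor g)) = cod (fmor F (un_mor f)).
  by rewrite fdom fcod k.
have e5 : dom (fmor F (un_mor g)) =
    cod (mcomp (fmor F (un_mor f)) (un_map (un_src f)) ef) by rewrite cod_mcomp.
have e6 : dom (mcomp (fmor F (un_mor g)) (fmor F (un_mor f)) e2) =
    cod (un_map (un_src f)) by rewrite dom_mcomp.
have e7 : dom (fmor F (mcomp (un_mor g) (un_mor f) k)) =
    cod (un_map (un_src f)) by rewrite (fcomp k e2).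
exists e7; rewrite -Eg; transitivity (mcomp _ _ e6).
  by apply: eq_comp => //; rewrite (fcomp k e2).
rewrite -(mcompA e5 e6); apply: eq_comp => //.
by rewrite Ef e.
Qed.
Next Obligation. by []. Qed.
Next Obligation. by []. Qed.
Next Obligation. by []. Qed.
Next Obligation. by []. Qed.
Next Obligation.
move=> C D F d f e; apply: under_mor_eq => //=.
have e' : dom (idm (cod (un_mor f))) = cod (un_mor f) by rewrite dom_idm.
by rewrite -[RHS](mcomp_idl e'); apply: eq_comp; rewrite ?un_mor_cod.
Qed.
Next Obligation.
move=> C D F d f e; apply: under_mor_eq => //=.
have e' : dom (un_mor f) = cod (idm (dom (un_mor f))) by rewrite cod_idm.
by rewrite -[RHS](mcomp_idr e'); apply: eq_comp; rewrite ?un_mor_dom.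
Qed.
Next Obligation.
by move=> C D F d h g f e1 e2 e3 e4; apply: under_mor_eq => //=; exact: mcompA.
Qed.

Program Definition under_translate_ob (gT : finGroupType) (C D : category)
    (aC : cat_action gT C) (aD : cat_action gT D) (F : functor C D)
    (hF : is_Gfunctor aC aD F) (d : ob D) (g : gT) (gd : aD g d = d)
    (x : under_ob F d) : under_ob F d :=
  @UnderOb C D F d (aC g (un_ob x)) (fmor (aD g) (un_map x)) _ _.
Next Obligation. by move=> gT C D aC aD F hF d g gd x; rewrite fdom un_dom. Qed.
Next Obligation.
by move=> gT C D aC aD F hF d g gd x; rewrite fcod un_cod (proj1 hF).
Qed.

Program Definition under_translate_mor (gT : finGroupType) (C D : category)
    (aC : cat_action gT C) (aD : cat_action gT D) (F : functor C D)
    (hF : is_Gfunctor aC aD F) (d : ob D) (g : gT) (gd : aD g d = d)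
    (h : under_mor F d) : under_mor F d :=
  @UnderMor C D F d (under_translate_ob hF gd (un_src h))
    (under_translate_ob hF gd (un_tgt h)) (fmor (aC g) (un_mor h)) _ _ _.
Next Obligation.
by move=> gT C D aC aD F hF d g gd h; rewrite fdom un_mor_dom.
Qed.
Next Obligation.
by move=> gT C D aC aD F hF d g gd h; rewrite fcod un_mor_cod.
Qed.
Next Obligation.
move=> gT C D aC aD F hF d g gd h /=.
have [e E] := un_mor_eq h.
have e1 : dom (fmor (aD g) (fmor F (un_mor h))) =
    cod (fmor (aD g) (un_map (un_src h))) by rewrite fdom fcod e.
have e2 : dom (fmor F (fmor (aC g) (un_mor h))) =
    cod (fmor (aD g) (un_map (un_src h))) by rewrite -e1 (proj2 hF).
exists e2; rewrite -E (fcomp e e1); apply: eq_comp => //.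
exact: (proj2 hF).
Qed.

Program Definition under_translate (gT : finGroupType) (C D : category)
    (aC : cat_action gT C) (aD : cat_action gT D) (F : functor C D)
    (hF : is_Gfunctor aC aD F) (d : ob D) (g : gT) (gd : aD g d = d) :
    functor (undercat F d) (undercat F d) :=
  @Functor (undercat F d) (undercat F d) (under_translate_ob hF gd)
    (under_translate_mor hF gd) (fun=> erefl) (fun=> erefl) _ _.
Next Obligation.
by move=> gT C D aC aD F hF d g gd x; apply: under_mor_eq => //=; rewrite fidm.
Qed.
Next Obligation.
move=> gT C D aC aD F hF d g gd k h e e'; apply: under_mor_eq => //=.
exact: fcomp.
Qed.

Program Definition under_action (gT : finGroupType) (C D : category)
    (aC : cat_action gT C) (aD : cat_action gT D) (F : functor C D)
    (hF : is_Gfunctor aC aD F) (d : ob D) :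
    cat_action (subg_of (stab aD d)) (undercat F d) :=
  @CatAction _ (undercat F d) (fun k => under_translate hF (stab_fix k)) _ _.
Next Obligation.
move=> gT C D aC aD F hF d.
have obE (x : under_ob F d) :
    under_translate hF (stab_fix (1%g : subg_of (stab aD d))) x = x.
  by apply: under_ob_eq => /=; apply act1E.
apply: eq_functor => // f; apply: under_mor_eq; try exact: obE.
by apply act1E.
Qed.
Next Obligation.
move=> gT C D aC aD F hF d g h.
have obE (x : under_ob F d) : under_translate hF (stab_fix (g * h)%g) x =
    under_translate hF (stab_fix g) (under_translate hF (stab_fix h) x).
  by apply: under_ob_eq => /=; apply actME.
apply: eq_functor => // f; apply: under_mor_eq; try exact: obE.
by apply actME.
Qed.

(* An n-simplex of the nerve of C is a functor [n] -> C, where [n] is the     *)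
(* poset 0 <= ... <= n. Functors [m] -> [n] are exactly the monotone maps, so *)
(* the simplicial operators are precompositions with such functors.           *)

Program Definition ordcat (n : nat) : category :=
  @Category 'I_n.+1 {p : 'I_n.+1 * 'I_n.+1 | (p.1 <= p.2)%N}
    (fun f => (val f).1) (fun f => (val f).2)
    (fun i => exist _ (i, i) _)
    (fun g f e => exist _ ((val f).1, (val g).2) _)
    _ _ _ _ _ _ _.
Next Obligation. by move=> n i /=. Qed.
Next Obligation.
move=> n [[j k] /= jk] [[i j'] /= ij] /= e.
by rewrite -e in ij; exact: leq_trans ij jk.
Qed.
Next Obligation. by []. Qed.
Next Obligation. by []. Qed.
Next Obligation. by []. Qed.
Next Obligation. by []. Qed.
Next Obligation. by move=> n [[i j] ij] e; apply: val_inj. Qed.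
Next Obligation. by move=> n [[i j] ij] e; apply: val_inj. Qed.
Next Obligation. by move=> n h g f e1 e2 e3 e4; apply: val_inj. Qed.

Definition nerve (C : category) (n : nat) : Type := functor (ordcat n) C.

Definition std_simplex (R : realType) (n : nat) : set 'rV[R]_n.+1 :=
  [set t | (forall i, 0 <= t ord0 i) /\ \sum_i t ord0 i = 1].
Arguments std_simplex R n _ : clear implicits.

Lemma push_simplex_subproof (R : realType) (m n : nat)
    (th : functor (ordcat m) (ordcat n)) (t : std_simplex R m) :
  (\row_j \sum_(i | th i == j) val t ord0 i) \in std_simplex R n.
Proof.
case: t => t /= /set_mem [t0 t1]; apply/mem_set; split=> [j|].
  by rewrite mxE; apply: sumr_ge0.
under eq_bigr do rewrite mxE.
by rewrite -t1 [RHS](partition_big (fob th) xpredT).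
Qed.

(* The affine map Delta^m -> Delta^n sending the vertex i to the vertex th i. *)
Definition push_simplex (R : realType) (m n : nat)
    (th : functor (ordcat m) (ordcat n)) (t : std_simplex R m) :
    std_simplex R n :=
  exist (fun u => u \in std_simplex R n) _ (push_simplex_subproof th t).

Definition simplex_of (C : category) : Type := {classic {n : nat & nerve C n}}.
HB.instance Definition _ (C : category) := Choice.on (simplex_of C).

Definition prerealization (R : realType) (C : category) : Type :=
  {s : simplex_of C & set_type (std_simplex R (tag s))}.
HB.instance Definition _ (R : realType) (C : category) :=
  Topological.copy (prerealization R C)
    {s : simplex_of C & set_type (std_simplex R (tag s))}.

Definition cell (R : realType) (C : category) (n : nat) (s : nerve C n)
    (t : std_simplex R n) : prerealization R C :=
  existT (fun s : simplex_of C => set_type (std_simplex R (tag s)))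
    (existT (nerve C) n s) t.

(* (s o th, t) ~ (s, th_* t) for every simplicial operator th. *)
Inductive glue (R : realType) (C : category) :
    prerealization R C -> prerealization R C -> Prop :=
  Glue (m n : nat) (th : functor (ordcat m) (ordcat n)) (s : nerve C n)
    (t : std_simplex R m) :
    glue (cell (functor_comp s th) t) (cell s (push_simplex th t)).

Definition glue_equiv (R : realType) (C : category) :
    rel (prerealization R C) :=
  fun x y => `[< clos_refl_sym_trans _ (@glue R C) x y >].

Lemma glue_equiv_is_equiv (R : realType) (C : category) :
  equiv_class_of (@glue_equiv R C).
Proof.
split=> [x|x y|y x z]; first by apply/asboolP; exact: rst_refl.
  by apply/asboolP/asboolP; exact: rst_sym.
by move=> /asboolP xy /asboolP yz; apply/asboolP; exact: rst_trans xy yz.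
Qed.

Canonical glue_equiv_rel (R : realType) (C : category) :=
  EquivRelPack (@glue_equiv_is_equiv R C).

Definition realization (R : realType) (C : category) : Type :=
  quotient_topology {eq_quot (glue_equiv_rel R C)}.
HB.instance Definition _ (R : realType) (C : category) :=
  Topological.copy (realization R C)
    (quotient_topology {eq_quot (glue_equiv_rel R C)}).
HB.instance Definition _ (R : realType) (C : category) :=
  Quotient.copy (realization R C)
    (quotient_topology {eq_quot (glue_equiv_rel R C)}).

Lemma realization_eqP (R : realType) (C : category) (x y : prerealization R C) :
  \pi_(realization R C) x = \pi_(realization R C) y <->
  clos_refl_sym_trans _ (@glue R C) x y.
Proof.
have P := @eqmodP _ (glue_equiv_rel R C) x y.
by split=> [/P /asboolP//|xy]; apply/P/asboolP.
Qed.

Definition prerealize (R : realType) (C D : category) (F : functor C D)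
    (x : prerealization R C) : prerealization R D :=
  cell (functor_comp F (projT2 (projT1 x))) (projT2 x).

Definition realize (R : realType) (C D : category) (F : functor C D)
    (x : realization R C) : realization R D :=
  \pi_(realization R D) (prerealize F (repr x)).

Lemma realize_pi (R : realType) (C D : category) (F : functor C D)
    (x : prerealization R C) :
  realize F (\pi_(realization R C) x) = \pi_(realization R D) (prerealize F x).
Proof.
have glueF (y z : prerealization R C) : clos_refl_sym_trans _ (@glue R C) y z ->
    clos_refl_sym_trans _ (@glue R D) (prerealize F y) (prerealize F z).
  elim=> {y z} [_ _ [m n th s t]|y|y z _|y z w _ yz _ zw].
  - apply: rst_step; rewrite /prerealize /=.
    have -> : functor_comp F (functor_comp s th) =
        functor_comp (functor_comp F s) th by exact: eq_functor.
    exact: (Glue th (functor_comp F s) t).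
  - exact: rst_refl.
  - exact: rst_sym.
  - exact: rst_trans yz zw.
by apply/realization_eqP/glueF/realization_eqP; exact: reprK.
Qed.

Lemma realize_id (R : realType) (C : category) (x : realization R C) :
  realize (functor_id C) x = x.
Proof.
rewrite -[x]reprK realize_pi; congr (\pi _).
case: (repr x) => -[n s] t; rewrite /prerealize /cell /=.
have -> // : functor_comp (functor_id C) s = s.
exact: eq_functor.
Qed.

Lemma realize_comp (R : realType) (A B C : category) (F : functor B C)
    (E : functor A B) (x : realization R A) :
  realize (functor_comp F E) x = realize F (realize E x).
Proof.
rewrite -[x]reprK (realize_pi E) !realize_pi; congr (\pi _).
case: (repr x) => -[n s] t; rewrite /prerealize /cell /=.
have -> : functor_comp (functor_comp F E) s = functor_comp F (functor_comp E s).
  exact: eq_functor.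
by [].
Qed.

Definition realize_action (R : realType) (gT : finGroupType) (C : category)
    (a : cat_action gT C) : gT -> realization R C -> realization R C :=
  fun g => realize (a g).

(* The homotopy h only matters on X * [0, 1]. *)
Definition homotopic (R : realType) (X Y : topologicalType) (f g : X -> Y) :
    Prop :=
  exists h : X * R -> Y,
    [/\ {within [set: X] `*` `[0, 1], continuous h},
        forall x, h (x, 0) = f x & forall x, h (x, 1) = g x].

Definition homotopy_equivalence (R : realType) (X Y : topologicalType)
    (f : X -> Y) : Prop :=
  continuous f /\ exists g : Y -> X,
    [/\ continuous g, homotopic R (g \o f) id & homotopic R (f \o g) id].

Definition contractible (R : realType) (X : topologicalType) : Prop :=
  exists x0 : X, homotopic R (@id X) (fun=> x0).

Definition fixed_points (gT : finGroupType) (X : Type) (aX : gT -> X -> X)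
    (H : {group gT}) : set X :=
  [set x | forall g, g \in H -> aX g x = x].

Definition equivariant (gT : finGroupType) (X Y : Type) (aX : gT -> X -> X)
    (aY : gT -> Y -> Y) (f : X -> Y) : Prop :=
  forall g x, f (aX g x) = aY g (f x).

Lemma fixed_map_subproof (gT : finGroupType) (X Y : Type)
    (aX : gT -> X -> X) (aY : gT -> Y -> Y) (f : X -> Y)
    (ef : equivariant aX aY f) (H : {group gT}) (x : fixed_points aX H) :
  f (val x) \in fixed_points aY H.
Proof.
by case: x => x /= /set_mem xH; apply/mem_set => g gH; rewrite -ef xH.
Qed.

Definition fixed_map (gT : finGroupType) (X Y : Type)
    (aX : gT -> X -> X) (aY : gT -> Y -> Y) (f : X -> Y)
    (ef : equivariant aX aY f) (H : {group gT}) (x : fixed_points aX H) :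
    fixed_points aY H :=
  exist (fun y => y \in fixed_points aY H) (f (val x))
    (fixed_map_subproof ef x).

Definition G_homotopy_equivalence (R : realType) (gT : finGroupType)
    (X Y : topologicalType) (aX : gT -> X -> X) (aY : gT -> Y -> Y)
    (f : X -> Y) : Prop :=
  continuous f /\ exists ef : equivariant aX aY f,
    forall H : {group gT}, homotopy_equivalence R (fixed_map ef (H := H)).

Definition G_contractible (R : realType) (kT : finGroupType) (E : category)
    (a : cat_action kT E) : Prop :=
  forall H : {group kT},
    contractible R (fixed_points (realize_action (R := R) a) H).

Definition G_homotopy_initial (R : realType) (gT : finGroupType)
    (C D : category) (aC : cat_action gT C) (aD : cat_action gT D)
    (F : functor C D) (hF : is_Gfunctor aC aD F) : Prop :=
  forall d : ob D, G_contractible R (over_action hF d).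

Definition G_homotopy_final (R : realType) (gT : finGroupType)
    (C D : category) (aC : cat_action gT C) (aD : cat_action gT D)
    (F : functor C D) (hF : is_Gfunctor aC aD F) : Prop :=
  forall d : ob D, G_contractible R (under_action hF d).

(* Main.v *)
Require Import Defs.
From Stdlib Require Import Relations.
From HB Require Import structures.
From mathcomp Require Import all_boot all_order all_algebra all_fingroup.
From mathcomp Require Import generic_quotient.
From mathcomp Require Import all_classical all_reals topology normedtype.
From mathcomp Require Import ring lra zify.
Import Defs.

Set Implicit Arguments.
Unset Strict Implicit.
Unset Printing Implicit Defensive.

Import Order.TTheory GRing.Theory Num.Theory.
Import numFieldNormedType.Exports.

Local Open Scope classical_set_scope.
Local Open Scope ring_scope.
Local Open Scope quotient_scope.
(** The theorem is Quillen's theorem A, applied to the functor between the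
    categories of H-fixed objects and arrows for every subgroup H.

    Reduction to fixed categories. The cumulative sums of the barycentric
    coordinates turn a point of a realization into a step function on [0, 1[
    with values in the category, and this step function does not depend on the
    chosen representative ([step_arrow_glue]). Hence the H-fixed points of |C|
    are the points of |C^H|, with the same topology ([fixed_points_homeo]). For
    an H-fixed object d, the slice of F^H over d is the H-fixed part of the
    slice of F over d, so that it is contractible ([over_fix_contractible],
    [under_fix_contractible]). It remains to show that a functor with
    contractible slices induces a homotopy equivalence ([quillenA]); the case of
    the slices under the objects follows by passing to opposite categories
    ([quillenA_final]).

    Theorem A by carriers. Functors P : A -> D and Q : B -> D assign to every
    simplex of A, with last vertex a, the space |Q over P a|; these spaces are
    covariant in the simplex. When they are contractible, one can choose maps
    from the simplices of A to these spaces that agree along all simplicial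
    operators, and two such choices are homotopic ([coherent_map_exists],
    [homotopic_coherent]): the maps are extended over the simplices of A one at
    a time, from the boundary of a prism to its interior ([coherent_family]).
    Composed with the forgetful functors to B, a choice yields a map from |A| to
    |B|. With P = id and Q = F, this is a map g : |D| -> |C|. With P = Q = F,
    both g |F| and the identity of |C| arise from such choices, hence they are
    homotopic. With P = Q = id, the same holds for |F| g and the identity of
    |D|; here the carriers are contractible because a category with a terminal
    object is ([terminal_contractible]). *)

Local Obligation Tactic := idtac.

(** * Homotopies *)

Definition clamp (R : realType) (u : R) : R := Num.max 0 (Num.min u 1).

Lemma clamp_continuous (R : realType) : continuous (@clamp R).
Proof.
move=> u; apply: (@continuous_max R R (cst 0) (fun v : R => Num.min v 1)).
  exact: cst_continuous.
apply: (@continuous_min R R id (cst 1)) => //; exact: cst_continuous.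
Qed.

Lemma clamp_itv (R : realType) (u : R) : `[0, 1]%classic (clamp u).
Proof.
by rewrite /= in_itv /= /clamp le_max lexx /= ge_max ler01 ge_min lexx orbT.
Qed.

Lemma clamp_le0 (R : realType) (u : R) : u <= 0 -> clamp u = 0.
Proof. by rewrite /clamp => u0; rewrite max_l// ge_min u0. Qed.

Lemma clamp_ge1 (R : realType) (u : R) : 1 <= u -> clamp u = 1.
Proof. by rewrite /clamp => u1; rewrite min_r// max_r. Qed.

Lemma pair_continuous (X Y Z : topologicalType) (f : X -> Y) (g : X -> Z) :
  continuous f -> continuous g -> continuous (fun x => (f x, g x)).
Proof. by move=> cf cg x; apply: cvg_pair; [exact: cf|exact: cg]. Qed.

Lemma pair_continuous_at (X Y Z : topologicalType) (f : X -> Y) (g : X -> Z) x :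
  {for x, continuous f} -> {for x, continuous g} ->
  {for x, continuous (fun x => (f x, g x))}.
Proof. by move=> cf cg; apply: cvg_pair. Qed.

Lemma comp_continuous (X Y Z : topologicalType) (f : X -> Y) (g : Y -> Z) :
  continuous f -> continuous g -> continuous (g \o f).
Proof. by move=> cf cg x; apply: continuous_comp; [exact: cf|exact: cg]. Qed.

(** Precomposition with [clamp] turns a homotopy into a map that is continuous
    on the whole of X * R and stationary outside the unit interval. All later
    constructions of homotopies are carried out on X * R. *)
Lemma homotopicP (R : realType) (X Y : topologicalType) (f g : X -> Y) :
  homotopic R f g <-> exists h : X * R -> Y,
    [/\ continuous h, forall x u, u <= 0 -> h (x, u) = f x &
        forall x u, 1 <= u -> h (x, u) = g x].
Proof.
split=> [[h [ch h0 h1]]|[h [ch h0 h1]]]; last first.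
  exists h; split=> [|x|x]; [exact: continuous_subspaceT|exact: h0|exact: h1].
exists (fun z => h (z.1, clamp z.2)); split=> [|x u u0|x u u1].
- move/subspace_continuousP: ch => ch [x u].
  pose q (z : X * R) := (z.1, clamp z.2).
  have cq : continuous q.
    apply: pair_continuous; first by move=> z; exact: cvg_fst.
    apply: comp_continuous (@clamp_continuous R).
    by move=> z; exact: cvg_snd.
  have Bq z : ([set: X] `*` `[0, 1]) (q z) by split=> //; exact: clamp_itv.
  have := ch _ (Bq (x, u)) => hq.
  apply: (@cvg_comp _ _ _ q h _ _ _ _ hq) => U wU.
  have : nbhs (q (x, u)) [set z | ([set: X] `*` `[0, 1]) z -> U z] by exact: wU.
  move/(cq (x, u)) => nU; apply: (@filterS _ (nbhs (x, u)) _ _ _ _ nU) => z.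
  by move/(_ (Bq z)).
- by rewrite /= clamp_le0.
- by rewrite /= clamp_ge1.
Qed.

Lemma homotopic_compl (R : realType) (X Y Z : topologicalType) (f g : X -> Y)
  (k : Y -> Z) :
  continuous k -> homotopic R f g -> homotopic R (k \o f) (k \o g).
Proof.
move=> ck /homotopicP[h [ch h0 h1]]; apply/homotopicP; exists (k \o h).
split=> [|x u u0|x u u1]; first exact: comp_continuous.
  by rewrite /= h0.
by rewrite /= h1.
Qed.

Lemma homotopic_compr (R : realType) (X Y Z : topologicalType) (f g : X -> Y)
  (k : Z -> X) :
  continuous k -> homotopic R f g -> homotopic R (f \o k) (g \o k).
Proof.
move=> ck /homotopicP[h [ch h0 h1]]; apply/homotopicP.
exists (fun z => h (k z.1, z.2)); split=> [|x u u0|x u u1].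
- apply: comp_continuous ch; apply: pair_continuous.
    by apply: comp_continuous ck => z; exact: cvg_fst.
  by move=> z; exact: cvg_snd.
- by rewrite /= h0.
- by rewrite /= h1.
Qed.

Lemma contractible_retract (R : realType) (X Y : topologicalType)
  (i : Y -> X) (r : X -> Y) : continuous i -> continuous r -> cancel i r ->
  contractible R X -> contractible R Y.
Proof.
move=> ci cr ir [x0 hx]; exists (r x0).
have -> : @id Y = r \o (id \o i) by apply/funext => y /=; rewrite ir.
exact: (homotopic_compl cr (homotopic_compr ci hx)).
Qed.

Lemma homotopy_equivalence_homeo (R : realType) (X Y X' Y' : topologicalType)
    (f : X -> Y) (f' : X' -> Y') (a : X' -> X) (a' : X -> X')
    (b : Y' -> Y) (b' : Y -> Y') :
  continuous a -> continuous a' -> cancel a' a -> cancel a a' ->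
  continuous b -> continuous b' -> cancel b' b -> cancel b b' ->
  f \o a =1 b \o f' -> homotopy_equivalence R f' -> homotopy_equivalence R f.
Proof.
move=> ca ca' a'K aK cb cb' b'K bK E [cf' [g [cg gf fg]]].
have Ef : f = b \o (f' \o a').
  by apply/funext => x /=; rewrite -[LHS]/(f x) -{1}(a'K x); exact: E.
split; first by rewrite Ef; do 2![apply: comp_continuous => //].
exists (a \o (g \o b')); split.
- by do 2![apply: comp_continuous => //].
- have -> : (a \o (g \o b')) \o f = a \o ((g \o f') \o a').
    by apply/funext => x /=; rewrite Ef /= bK.
  have -> : @id X = a \o (id \o a') by apply/funext => x /=; rewrite a'K.
  exact: (homotopic_compl ca (homotopic_compr ca' gf)).
- have -> : f \o (a \o (g \o b')) = b \o ((f' \o g) \o b').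
    by apply/funext => x /=; rewrite Ef /= aK.
  have -> : @id Y = b \o (id \o b') by apply/funext => x /=; rewrite b'K.
  exact: (homotopic_compl cb (homotopic_compr cb' fg)).
Qed.

(** * Maps out of a realization *)

Definition pt (R : realType) (A : category) n (s : nerve A n)
    (t : std_simplex R n) : realization R A :=
  \pi_(realization R A) (cell s t).

Lemma pt_continuous (R : realType) (A : category) n (s : nerve A n) :
  continuous (@pt R A n s).
Proof.
apply: (@comp_continuous _ (prerealization R A) (realization R A)
  (fun t : std_simplex R n => cell s t)).
  move=> t; exact: (@existT_continuous (simplex_of A)
    (fun s : simplex_of A => set_type (std_simplex R (tag s)))
    (existT (nerve A) n s)).
exact: pi_continuous.
Qed.

Lemma pt_glue (R : realType) (A : category) m n
    (th : functor (ordcat m) (ordcat n)) (s : nerve A n) (t : std_simplex R m) :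
  pt (functor_comp s th) t = pt s (push_simplex th t).
Proof. by apply/realization_eqP/rst_step. Qed.

Lemma realization_ind (R : realType) (A : category) (P : realization R A -> Prop) :
  (forall n (s : nerve A n) (t : std_simplex R n), P (pt s t)) -> forall x, P x.
Proof.
move=> h x; rewrite -[x]reprK; case: (repr x) => -[n s] t; exact: (h n s t).
Qed.

(** A quotient map remains one after taking the product with R, because R is
    locally compact: if K is a closed ball and O is open, then the points x such
    that h maps {x} * K into O form an open set, by the tube lemma on each
    simplex. *)
Lemma realization_homotopy (R : realType) (A : category) (Y : topologicalType)
    (k : forall n, nerve A n -> std_simplex R n * R -> Y) :
  (forall n s, continuous (@k n s)) ->
  (forall m n (th : functor (ordcat m) (ordcat n)) (s : nerve A n) t u,
     k _ (functor_comp s th) (t, u) = k _ s (push_simplex th t, u)) ->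
  exists2 h : realization R A * R -> Y, continuous h &
    forall n (s : nerve A n) t u, h (pt s t, u) = k _ s (t, u).
Proof.
move=> ck kE.
pose pk (x : prerealization R A) (u : R) : Y :=
  k _ (projT2 (projT1 x)) (projT2 x, u).
have pkE x y : clos_refl_sym_trans _ (@glue R A) x y -> forall u, pk x u = pk y u.
  elim=> {x y} [_ _ [m n th s t] u|//|x y _ + u|x y z _ + _ + u].
  - exact: kE.
  - by move=> ->.
  - by move=> -> ->.
pose h (z : realization R A * R) := pk (repr z.1) z.2.
have hE x u : h (\pi_(realization R A) x, u) = pk x u.
  by apply: pkE; apply/realization_eqP; exact: reprK.
exists h => [|n s t u]; last by rewrite /pt hE.
move=> [x0 u0] U; rewrite nbhsE => -[O [oO]].
rewrite -[x0]reprK hE; case: (repr x0) => -[m s] t Ost /filterS; apply.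
have [[/= W1 W2] [tW1 uW2] WO] : nbhs (t, u0) (k m s @^-1` O).
  by apply: ck; exact: open_nbhs_nbhs.
have [e e0 eW2] : exists2 e, 0 < e & closed_ball u0 e `<=` W2.
  have /nbhs_ballP[e /= e0 eW2] : nbhs u0 W2 by [].
  exists (e / 2); first by rewrite divr_gt0.
  apply: subset_trans eW2; apply: closed_ball_subset; first by rewrite divr_gt0.
  by rewrite ltr_pdivrMr // ltr_pMr // ltr1n.
pose V := [set x | closed_ball u0 e `<=` fun u => O (h (x, u))].
have oV : open V.
  apply/(sigT_openP (_ : set (prerealization R A))) => -[n s'].
  rewrite openE => t' t'V; rewrite /interior /=.
  have /compact_near_coveringP cov := closed_ballR_compact (x := u0) e0.
  have tO : \near t', closed_ball u0 e `<=` fun u => O (k n s' (t', u)).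
    apply: (cov _ (nbhs t') (fun t u => O (k n s' (t, u)))) => u /t'V.
    rewrite hE => Ou.
    have [[/= W3 W4] [tW3 uW4] WO'] : nbhs (t', u) (k n s' @^-1` O).
      by apply: ck; exact: open_nbhs_nbhs.
    by exists (W4, W3) => //= -[u' t''] [/= ? ?]; apply: (WO' (t'', u')).
  by apply: filterS tO => t'' tO u /tO; rewrite hE.
exists (V, closed_ball u0 e) => /=.
  split; last by apply/nbhs_ballP; exists e => //=; exact: subset_closed_ball.
  apply: open_nbhs_nbhs; split=> //= u uB; rewrite hE.
  by apply: (WO (t, u)); split; [exact: nbhs_singleton|exact: eW2].
by case=> x u /= [xV /xV].
Qed.

Lemma realization_map (R : realType) (A : category) (Y : topologicalType)
    (k : forall n, nerve A n -> std_simplex R n -> Y) :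
  (forall n s, continuous (@k n s)) ->
  (forall m n (th : functor (ordcat m) (ordcat n)) (s : nerve A n) t,
     k _ (functor_comp s th) t = k _ s (push_simplex th t)) ->
  exists2 h : realization R A -> Y, continuous h &
    forall n (s : nerve A n) t, h (pt s t) = k _ s t.
Proof.
move=> ck kE.
have [||h ch hE] := @realization_homotopy R A Y (fun n s z => k n s z.1).
- move=> n s; apply: comp_continuous (ck n s) => z; exact: cvg_fst.
- by move=> *; exact: kE.
exists (fun x => h (x, 0)) => [|n s t]; last exact: hE.
apply: (comp_continuous _ ch); apply: pair_continuous => [x|].
  exact: cvg_id.
exact: cst_continuous.
Qed.

Lemma realize_pt (R : realType) (C D : category) (F : functor C D) n
    (s : nerve C n) (t : std_simplex R n) :
  realize F (pt s t) = pt (functor_comp F s) t.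
Proof. exact: realize_pi. Qed.

Lemma functor_compA (A B C D : category) (H : functor C D) (G : functor B C)
    (F : functor A B) :
  functor_comp (functor_comp H G) F = functor_comp H (functor_comp G F).
Proof. exact: eq_functor. Qed.

Lemma functor_comp_idr (A B : category) (F : functor A B) :
  functor_comp F (functor_id A) = F.
Proof. exact: eq_functor. Qed.

Lemma realize_continuous (R : realType) (C D : category) (F : functor C D) :
  continuous (realize (R := R) F).
Proof.
have [||h ch hE] := @realization_map R C (realization R D)
    (fun n s t => pt (functor_comp F s) t).
- by move=> n s; exact: pt_continuous.
- by move=> m n th s t; rewrite -functor_compA pt_glue.
suff -> : realize F = h by [].
apply/funext; apply: realization_ind => n s t; by rewrite hE realize_pt.
Qed.

(** * Monotone maps and barycentric coordinates *)

Definition coord (R : realType) n (t : std_simplex R n) (i : 'I_n.+1) : R :=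
  val t ord0 i.

Lemma coord_ge0 (R : realType) n (t : std_simplex R n) i : 0 <= coord t i.
Proof. by have [t0 _] := set_mem (valP t); exact: t0. Qed.

Lemma sum_coord (R : realType) n (t : std_simplex R n) : \sum_i coord t i = 1.
Proof. by have [] := set_mem (valP t). Qed.

Lemma eq_simplex (R : realType) n (t t' : std_simplex R n) :
  coord t =1 coord t' -> t = t'.
Proof. by move=> tt'; apply: val_inj; apply/rowP => i; exact: tt'. Qed.

Lemma coord_continuous (R : realType) n (i : 'I_n.+1) :
  continuous (fun t : std_simplex R n => coord t i).
Proof.
apply: (@comp_continuous _ 'rV[R]_n.+1 _ (fun t : std_simplex R n => val t)
  (fun u : 'rV[R]_n.+1 => u ord0 i)).
  exact: initial_continuous.
exact: matrix_normedtype.coord_continuous.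
Qed.

Lemma simplex_continuous (R : realType) n (X : topologicalType)
    (f : X -> std_simplex R n) x :
  (forall i, {for x, continuous (fun x => coord (f x) i)}) -> {for x, continuous f}.
Proof.
move=> cf U [_ /= [[W oW <-]]] /= Wfx /filterS; apply.
have [P nP PW] : nbhs (val (f x)) W by exact: open_nbhs_nbhs.
have : \near x, forall i, P ord0 i (coord (f x) i).
  by apply: filter_forall => i; apply: cf; exact: nP.
by apply: filterS => y Py; apply: PW => j i; rewrite (ord1 j); exact: Py.
Qed.

Lemma coord_push (R : realType) m n (th : functor (ordcat m) (ordcat n))
    (t : std_simplex R m) j :
  coord (push_simplex th t) j = \sum_(i | th i == j) coord t i.
Proof. by rewrite /coord mxE. Qed.

Lemma push_continuous (R : realType) m n (th : functor (ordcat m) (ordcat n)) :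
  continuous (push_simplex (R := R) th).
Proof.
move=> t; apply: simplex_continuous => j.
have -> : (fun t => coord (push_simplex th t) j) =
    (fun t : std_simplex R m => \sum_(i | th i == j) coord t i).
  by apply/funext => u; rewrite coord_push.
have C : continuous
    (fun t : std_simplex R m => \sum_(i | th i == j) coord t i).
  apply: (@continuous_big R _ _ 0 (fun i => th i == j)
    (@add_continuous R^o)) => i _; exact: coord_continuous.
exact: C.
Qed.

Lemma push_comp (R : realType) l m n (th : functor (ordcat m) (ordcat n))
    (ph : functor (ordcat l) (ordcat m)) (t : std_simplex R l) :
  push_simplex (functor_comp th ph) t = push_simplex th (push_simplex ph t).
Proof.
apply: eq_simplex => k; rewrite !coord_push /=.
rewrite (partition_big ph (fun j => th j == k)) //=.
apply: eq_bigr => j /eqP <-; rewrite coord_push; apply: eq_bigl => i.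
by apply/andP/idP => [[]//|/eqP ->]; rewrite !eqxx.
Qed.

(** In particular, a retraction onto the support of a point does not move it. *)
Lemma push_fix (R : realType) n (th : functor (ordcat n) (ordcat n))
    (t : std_simplex R n) :
  (forall i, coord t i != 0 -> th i = i) -> push_simplex th t = t.
Proof.
move=> fix_th; apply: eq_simplex => j; rewrite coord_push.
have [tj0|tj0] := eqVneq (coord t j) 0.
  rewrite tj0 big1 // => i /eqP thi; apply/eqP; apply/negP => /negP ti.
  by move: (ti); rewrite -(fix_th _ ti) thi tj0 eqxx.
rewrite (bigD1 j) /= ?fix_th // big1 ?addr0 // => i /andP[/eqP thi ij].
apply/eqP; apply/negP => /negP ti; move: ij.
by rewrite -thi (fix_th _ ti) eqxx.
Qed.

Lemma push_id (R : realType) n (t : std_simplex R n) :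
  push_simplex (functor_id (ordcat n)) t = t.
Proof. exact: push_fix. Qed.

Definition ord_arrow n (i j : 'I_n.+1) (ij : (i <= j)%N) : mor (ordcat n) :=
  exist (fun p : 'I_n.+1 * 'I_n.+1 => (p.1 <= p.2)%N) (i, j) ij.

Lemma ordcat_monotone m n (th : functor (ordcat m) (ordcat n)) (i j : 'I_m.+1) :
  (i <= j)%N -> (th i <= th j)%N.
Proof.
move=> ij; have := valP (fmor th (ord_arrow ij)).
have -> : (val (fmor th (ord_arrow ij))).1 = th i := fdom th (ord_arrow ij).
by have -> : (val (fmor th (ord_arrow ij))).2 = th j := fcod th (ord_arrow ij).
Qed.

Lemma eq_ord_functor (m n : nat) (th ph : functor (ordcat m) (ordcat n)) :
  (forall i, th i = ph i) -> th = ph.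
Proof.
move=> e; apply: eq_functor => // f; apply: val_inj.
have E (h : functor (ordcat m) (ordcat n)) :
    val (fmor h f) = (h (dom f), h (cod f)).
  by rewrite -fdom -fcod; case: (fmor h f) => -[].
by rewrite !E !e.
Qed.

Program Definition monotone m n (f : 'I_m.+1 -> 'I_n.+1)
    (fm : forall i j : 'I_m.+1, (i <= j)%N -> (f i <= f j)%N) :
    functor (ordcat m) (ordcat n) :=
  @Functor (ordcat m) (ordcat n) f (fun a => ord_arrow (fm _ _ (valP a)))
    _ _ _ _.
Next Obligation. by []. Qed.
Next Obligation. by []. Qed.
Next Obligation. by move=> *; apply: val_inj. Qed.
Next Obligation. by move=> *; apply: val_inj. Qed.

Lemma monotone_section m n (th : functor (ordcat m) (ordcat n))
    (g : 'I_n.+1 -> 'I_m.+1) : (forall j, th (g j) = j) ->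
  forall i j : 'I_n.+1, (i <= j)%N -> (g i <= g j)%N.
Proof.
move=> gK i j ij; rewrite leqNgt; apply/negP => gji.
have := ordcat_monotone th (ltnW gji); rewrite !gK => ji.
have e : i = j by apply/val_inj/eqP; rewrite eqn_leq ij ji.
by rewrite e ltnn in gji.
Qed.

Definition is_section m n (th : functor (ordcat m) (ordcat n))
    (sg : functor (ordcat n) (ordcat m)) := functor_comp th sg = functor_id _.

(** The freedom in the choice of the section shows that a surjective monotone
    map is determined by its sections. *)
Lemma surj_section m n (th : functor (ordcat m) (ordcat n)) (i0 : 'I_m.+1) :
  (forall j, exists i, th i = j) ->
  exists2 sg, is_section th sg & sg (th i0) = i0.
Proof.
move=> surj; pose g j := if j == th i0 then i0 else sval (cid (surj j)).
have gK j : th (g j) = j.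
  by rewrite /g; case: eqP => [->//|_]; exact: (svalP (cid (surj j))).
exists (monotone (monotone_section gK)); last by rewrite /= /g eqxx.
by apply: eq_ord_functor => j; exact: gK.
Qed.

Lemma section_or_miss m n (th : functor (ordcat m) (ordcat n)) :
  (exists sg, is_section th sg) \/ (exists i, forall k, th k <> i).
Proof.
have [surj|] := pselect (forall j, exists i, th i = j).
  by left; have [sg] := surj_section ord0 surj; exists sg.
move=> /existsNP[i ni]; right; exists i => k thk; apply: ni; by exists k.
Qed.

Lemma face_subproof n (i : 'I_n.+2) (j k : 'I_n.+1) :
  (j <= k)%N -> (lift i j <= lift i k)%N.
Proof. by rewrite leq_bump2. Qed.

Definition face n (i : 'I_n.+2) : functor (ordcat n) (ordcat n.+1) :=
  monotone (@face_subproof n i).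

Lemma degen_subproof n (i : 'I_n.+2) (j k : 'I_n.+2) : (j <= k)%N ->
  ((inord (minn (unbump i j) n) : 'I_n.+1) <=
   (inord (minn (unbump i k) n) : 'I_n.+1))%N.
Proof.
move=> jk; rewrite !inordK ?ltnS ?geq_minr // leq_min geq_minr andbT.
rewrite geq_min; apply/orP; left; rewrite /unbump.
by case: ltnP; case: ltnP; lia.
Qed.

Definition degen n (i : 'I_n.+2) : functor (ordcat n.+1) (ordcat n) :=
  monotone (@degen_subproof n i).

(** A map that misses i and fixes all other vertices, factored through dimension
    n - 1. Nothing can be missed if n = 0, and the value is then a default. *)
Definition collapse n : 'I_n.+1 -> functor (ordcat n) (ordcat n) :=
  match n with
  | 0 => fun=> functor_id _
  | n'.+1 => fun i => functor_comp (face i) (degen i)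
  end.

Lemma collapse_fix n (i k : 'I_n.+1) : k != i -> collapse i k = k.
Proof.
case: n i k => [|n] i k ki; first by [].
apply: val_inj; rewrite /= inordK ?ltnS ?geq_minr //.
have ki' : (k != i :> nat) by [].
have := ltn_ord k; have := ltn_ord i; rewrite /bump /unbump.
by case: ltnP; lia.
Qed.

Lemma coord0_pos (R : realType) n (t : std_simplex R n) i :
  coord t i = 0 -> (0 < n)%N.
Proof.
case: n t i => // t i; have := sum_coord t; rewrite big_ord_recl big_ord0 addr0.
by rewrite (ord1 i) => -> /eqP; rewrite oner_eq0.
Qed.

Lemma push_collapse (R : realType) n (t : std_simplex R n) i :
  coord t i = 0 -> push_simplex (collapse i) t = t.
Proof.
move=> ti; apply: push_fix => k tk; apply: collapse_fix.
by apply: contra_neq tk => ->.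
Qed.

(** * Extending maps from the boundary of a prism *)

Lemma continuous_near (X Y : topologicalType) (f g : X -> Y) x :
  (\near x, f x = g x) -> {for x, continuous f} -> {for x, continuous g}.
Proof.
move=> fg cf U; rewrite -(nbhs_singleton fg) => /cf fU.
by apply: (@filterS2 _ (nbhs x) _ _ _ _ _ fg fU) => y /= <-.
Qed.

(** The number [lam z] is the depth of z in Z: the map is prescribed at depth 0,
    and r is a radial projection onto these points, undefined at depth 1. The
    extension applies to [b (r z)] the contraction of E at time [2 * lam z]. It
    is constant for depths above 1/2, hence continuous where r is not. *)
Lemma cone_extension (R : realType) (Z E : topologicalType) (lam : Z -> R)
    (r : Z -> Z) (b : Z -> E) :
  contractible R E -> continuous lam ->
  (forall z, lam z < 1 -> {for z, continuous r}) ->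
  (forall z, lam z < 1 -> lam (r z) = 0) ->
  (forall z, lam z = 0 -> r z = z) ->
  {within [set z | lam z = 0], continuous b} ->
  exists2 f : Z -> E, continuous f & forall z, lam z = 0 -> f z = b z.
Proof.
move=> [x0 /homotopicP[h [ch h0 h1]]] cl cr lr rid /subspace_continuousP cb.
exists (fun z => h (b (r z), lam z + lam z)); last first.
  by move=> z lz; rewrite lz addr0 h0 // rid.
move=> z; have [lz|lz] := ltP (lam z) 1.
- have cbr : {for z, continuous (b \o r)}.
    have cbr := cb _ (lr _ lz).
    apply: (@cvg_comp _ _ _ r b _ _ _ _ cbr) => U /= wU.
    have rU := cr z lz [set z | lam z = 0 -> U z] wU.
    have nl := cl z [set y | y < 1] (lt_nbhsl lz).
    apply: (@filterS2 _ (nbhs z) _ _ _ _ _ nl rU) => y ly.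
    by move/(_ (lr _ ly)).
  have cll : {for z, continuous (fun z => lam z + lam z)}.
    by apply: (@cvgD _ R); exact: cl.
  apply: (@continuous_comp _ _ _ (fun z => (b (r z), lam z + lam z)) h).
    exact: pair_continuous_at cbr cll.
  exact: ch.
- have z2 : 1 / 2 < lam z by lra.
  have nl := cl z [set y | 1 / 2 < y] (lt_nbhsr z2).
  apply: (@continuous_near _ _ (cst x0)); last exact: cst_continuous.
  by apply: (@filterS _ (nbhs z) _ _ _ _ nl) => y /= ly; rewrite h1 //; lra.
Qed.

Definition mincoord (R : realType) n (t : std_simplex R n) : R :=
  \big[Num.min/1]_i coord t i.

Lemma mincoord_le (R : realType) n (t : std_simplex R n) i :
  mincoord t <= coord t i.
Proof. exact: bigmin_le. Qed.

Lemma coord_le1 (R : realType) n (t : std_simplex R n) i : coord t i <= 1.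
Proof.
rewrite -(sum_coord t) (bigD1 i) //= lerDl sumr_ge0 // => j _.
exact: coord_ge0.
Qed.

Lemma mincoord_eq (R : realType) n (t : std_simplex R n) :
  exists i, mincoord t = coord t i.
Proof.
have [|//] : mincoord t = 1 \/ exists i, mincoord t = coord t i.
  rewrite /mincoord; elim/big_ind: _ => [|x y px py|i _]; first by left.
    by rewrite /Num.min; case: ifP.
  by right; exists i.
move=> t1; exists ord0; apply/eqP; rewrite eq_le mincoord_le t1.
exact: coord_le1.
Qed.

Lemma mincoord_ge0 (R : realType) n (t : std_simplex R n) : 0 <= mincoord t.
Proof. by have [i ->] := mincoord_eq t; exact: coord_ge0. Qed.

Lemma mincoord_continuous (R : realType) n : continuous (@mincoord R n).
Proof.
apply: (@continuous_big R _ _ 1 xpredT) => [z|i _]; last exact: coord_continuous.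
by apply: continuous_min; [exact: cvg_fst|exact: cvg_snd].
Qed.

(** The depth of a height in a prism. Values are prescribed at the heights where
    the gauge vanishes, and the projection from the height [gcenter] leads
    there. Two gauges are used: the constant 1, which prescribes nothing, and
    the tent function, which prescribes the values outside ]0, 1[. *)
Record gauge (R : realType) := Gauge {
  gfun :> R -> R;
  gcenter : R -> R;
  gfun_cont : continuous gfun;
  gcenter_cont : continuous gcenter;
  gfun_ge0 : forall u, 0 <= gfun u;
  gauge_end : forall u, gfun u < 1 ->
    gfun ((u - gfun u * gcenter u) / (1 - gfun u)) = 0 }.

Section prism.
Variables (R : realType) (mu : gauge R) (n : nat).
Implicit Type z : std_simplex R n * R.

Let N : R := n.+1%:R.

Let N_gt0 : 0 < N. Proof. by rewrite /N ltr0Sn. Qed.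

(* The depth of a point of the prism: it vanishes exactly where the map is   *)
(* prescribed, and takes the value 1 over the barycenter only.               *)
Let lam z : R := Num.min (mu z.2) (N * mincoord z.1).

Let lam_le z i : lam z / N <= coord z.1 i.
Proof.
rewrite ler_pdivrMr // mulrC ge_min; apply/orP; right.
by rewrite ler_pM2l // mincoord_le.
Qed.

Let lam_continuous : continuous lam.
Proof.
move=> z; apply: (@continuous_min R _ (fun z => mu z.2)
    (fun z => N * mincoord z.1)).
  apply: (@comp_continuous _ _ _ snd mu) => [y|]; first exact: cvg_snd.
  exact: gfun_cont.
apply: (@comp_continuous _ R R (fun z => mincoord z.1) (fun x => N * x)).
  apply: (@comp_continuous _ _ R fst (@mincoord R n)) => [y|].
    exact: cvg_fst.
  exact: mincoord_continuous.
exact: mulrl_continuous.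
Qed.

(* The projection of the base from the barycenter; [r] is the projection of  *)
(* the prism from the point above the barycenter whose height is [gcenter].  *)
Let pushed z : 'rV[R]_n.+1 := \row_i ((coord z.1 i - lam z / N) / (1 - lam z)).

Let pushed_in z : lam z < 1 -> pushed z \in std_simplex R n.
Proof.
move=> l1; have l1' : 0 < 1 - lam z by lra.
apply/mem_set; split=> [i|].
  by rewrite mxE divr_ge0 ?(ltW l1') // subr_ge0 lam_le.
under eq_bigr do rewrite mxE.
rewrite -mulr_suml sumrB sum_coord sumr_const card_ord -[_ *+ n.+1]mulr_natr.
by rewrite -mulrA mulVf ?mulr1 ?divff ?lt0r_neq0.
Qed.

Let r z : std_simplex R n * R :=
  (insubd z.1 (pushed z), (z.2 - lam z * gcenter mu z.2) / (1 - lam z)).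

Let coord_r z i : lam z < 1 ->
  coord (r z).1 i = (coord z.1 i - lam z / N) / (1 - lam z).
Proof. by move=> l1; rewrite /coord val_insubd pushed_in // mxE. Qed.

Let r_continuous z : lam z < 1 -> {for z, continuous r}.
Proof.
move=> l1; have n1 : 1 - lam z != 0 by lra.
have cden : {for z, continuous (fun z => (1 - lam z)^-1 : R)}.
  apply: (@cvgV R) => //; apply: (@cvgB _ R); first exact: cvg_cst.
  exact: lam_continuous.
apply: pair_continuous_at; last first.
  apply: (@cvgM R) => //; apply: (@cvgB _ R); first exact: cvg_snd.
  apply: (@cvgM R); first exact: lam_continuous.
  apply: (@comp_continuous _ _ _ snd (gcenter mu)) => [y|]; first exact: cvg_snd.
  exact: gcenter_cont.
apply: simplex_continuous => i.
apply: (@continuous_near _ _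
    (fun z => (coord z.1 i - lam z / N) / (1 - lam z))).
  have nl := @lam_continuous z [set y | y < 1] (lt_nbhsl l1).
  by apply: (@filterS _ (nbhs z) _ _ _ _ nl) => y /= ly; rewrite -coord_r.
apply: (@cvgM R) => //; apply: (@cvgB _ R).
  apply: (@comp_continuous _ _ R fst
    (fun t : std_simplex R n => coord t i)) => [y|]; first exact: cvg_fst.
  exact: coord_continuous.
apply: (@cvgM R); first exact: lam_continuous.
exact: cvg_cst.
Qed.

Let lam_ge0 z : 0 <= lam z.
Proof.
by rewrite le_min gfun_ge0 /= mulr_ge0 ?mincoord_ge0 // ltW.
Qed.

Let lam_r z : lam z < 1 -> lam (r z) = 0.
Proof.
move=> l1; apply/eqP; rewrite eq_le lam_ge0 andbT.
have [e|e] : lam z = mu z.2 \/ lam z = N * mincoord z.1.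
  by rewrite /lam /Num.min; case: ifP => _; [left|right].
- rewrite ge_min; apply/orP; left.
  by rewrite /r /= e gauge_end // -e.
- rewrite ge_min; apply/orP; right.
  have [i ti] := mincoord_eq z.1.
  have := mincoord_le (r z).1 i.
  rewrite coord_r // e ti [N * _]mulrC mulfK ?gt_eqF // subrr mul0r => m0.
  by rewrite pmulr_rle0.
Qed.

Let r_id z : lam z = 0 -> r z = z.
Proof.
move=> l0; have l1 : lam z < 1 by rewrite l0.
rewrite [r z]surjective_pairing [RHS]surjective_pairing; congr pair.
  by apply: eq_simplex => i; rewrite coord_r // l0 mul0r !subr0 divr1.
by rewrite /r /= l0 mul0r !subr0 divr1.
Qed.

Let lam0P z :
  lam z = 0 <-> mu z.2 = 0 \/ exists i, coord z.1 i = 0.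
Proof.
split=> [|[m0|[i ti]]].
- rewrite /lam /Num.min; case: ifP => _; first by left.
  move=> /eqP; rewrite mulf_eq0 gt_eqF //= => /eqP m0.
  by right; have [i] := mincoord_eq z.1; exists i; rewrite -m0.
- by apply/eqP; rewrite eq_le lam_ge0 andbT ge_min m0 lexx.
- apply/eqP; rewrite eq_le lam_ge0 andbT ge_min pmulr_rle0 //.
  by rewrite -[X in mincoord _ <= X]ti mincoord_le orbT.
Qed.

(** A map on the boundary of a prism is glued from its restrictions to the
    closed faces; there the cone formula applies. *)
Lemma prism_extension (E : topologicalType) (f0 : std_simplex R n * R -> E)
    (g : 'I_n.+1 -> std_simplex R n * R -> E) :
  contractible R E ->
  {within [set z | mu z.2 = 0], continuous f0} ->
  (forall i, continuous (g i)) ->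
  (forall i z, mu z.2 = 0 -> coord z.1 i = 0 -> g i z = f0 z) ->
  (forall i j z, coord z.1 i = 0 -> coord z.1 j = 0 -> g i z = g j z) ->
  exists2 f, continuous f & (forall z, mu z.2 = 0 -> f z = f0 z) /\
    (forall i z, coord z.1 i = 0 -> f z = g i z).
Proof.
move=> cE /subspace_continuousP cf0 cg gf0 gg.
pose b z := if mu z.2 == 0 then f0 z else
  if [pick i | coord z.1 i == 0] is Some i then g i z else f0 z.
have bf0 z : mu z.2 = 0 -> b z = f0 z by rewrite /b => ->; rewrite eqxx.
have bg i z : coord z.1 i = 0 -> b z = g i z.
  move=> ti; rewrite /b; case: eqP => [m0|_]; first by rewrite (gf0 i).
  case: pickP => [j /eqP tj|/(_ i)]; first exact: gg.
  by rewrite ti eqxx.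
have cb : {within [set z | lam z = 0], continuous b}.
  apply/subspace_continuousP => z /= /lam0P zB U Ubz.
  have n0 : \near z, mu z.2 = 0 -> U (f0 z).
    have [m0|m0] := eqVneq (mu z.2) 0.
      have Uf : nbhs (f0 z) U by rewrite -bf0.
      exact: (cf0 z m0 U Uf).
    have cm : continuous (fun z : std_simplex R n * R => mu z.2).
      apply: (@comp_continuous _ _ _ snd mu) => [y|]; first exact: cvg_snd.
      exact: gfun_cont.
    have nz := cm z [set y | y != 0] (open_nbhs_nbhs (conj (@open_neq R 0) m0)).
    by apply: (@filterS _ (nbhs z) _ _ _ _ nz) => y /= /eqP.
  have ng : \near z, forall i, coord z.1 i = 0 -> U (g i z).
    suff H i : nbhs z [set y | coord y.1 i = 0 -> U (g i y)].
      exact: (filter_forall (nbhs_filter z) H).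
    have [t0|t0] := eqVneq (coord z.1 i) 0.
      have Ug : nbhs (g i z) U by rewrite -bg.
      by apply: (@filterS _ (nbhs z) _ _ _ _ (cg i z U Ug)) => y Uy _.
    have cm : continuous (fun z : std_simplex R n * R => coord z.1 i).
      apply: (@comp_continuous _ _ R fst (fun t : std_simplex R n => coord t i)) => [y|].
        exact: cvg_fst.
      exact: coord_continuous.
    have nz := cm z [set y | y != 0] (open_nbhs_nbhs (conj (@open_neq R 0) t0)).
    by apply: (@filterS _ (nbhs z) _ _ _ _ nz) => y /= /eqP.
  apply: (@filterS2 _ (nbhs z) _ _ _ _ _ n0 ng) => y n0y ngy /lam0P yB.
  suff : U (b y) by [].
  case: yB => [m0|[i ti]]; first by rewrite bf0 //; exact: n0y.
  by rewrite (bg i) //; exact: ngy.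
have [f cf fb] := cone_extension cE lam_continuous r_continuous lam_r r_id cb.
exists f => //; split=> [z m0|i z ti].
  by rewrite fb ?bf0 //; apply/lam0P; left.
by rewrite fb ?(bg i) //; apply/lam0P; right; exists i.
Qed.

End prism.

Lemma injective_monotone_ge n (q : functor (ordcat n) (ordcat n)) :
  injective q -> forall k : 'I_n.+1, (k <= q k)%N.
Proof.
move=> qI [k kn]; elim: k kn => [//|k IH] kn.
have kn' : (k < n.+1)%N by exact: ltnW.
apply: leq_ltn_trans (IH kn') _; rewrite ltn_neqAle.
rewrite (@ordcat_monotone _ _ q (Ordinal kn') (Ordinal kn)) ?leqnSn // andbT.
by apply/eqP => /val_inj /qI [] /eqP; rewrite eqn_leq ltnn andbF.
Qed.

Lemma monotone_endo_id n (q : functor (ordcat n) (ordcat n)) :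
  (exists sg, is_section q sg) -> forall k : 'I_n.+1, q k = k.
Proof.
move=> [sg qsg] k.
have sgK : cancel sg q by move=> j; rewrite -[RHS]/(functor_id (ordcat n) j) -qsg.
have qK : cancel q sg by exact: canF_sym sgK.
apply/val_inj/eqP; rewrite eqn_leq injective_monotone_ge ?andbT.
  have := ordcat_monotone q (injective_monotone_ge (can_inj sgK) k).
  by rewrite sgK.
exact: can_inj qK.
Qed.

Lemma retraction n (A : {set 'I_n.+1}) (a0 : 'I_n.+1) : a0 \in A ->
  exists e : functor (ordcat n) (ordcat n),
    (forall k : 'I_n.+1, e k \in A) /\ (forall a : 'I_n.+1, a \in A -> e a = a).
Proof.
move=> a0A; pose m := [arg min_(a < a0 in A) val a]%N.
have [mA mmin] : m \in A /\ forall a, a \in A -> (m <= a)%N.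
  by rewrite /m; case: arg_minnP.
(* The largest element of A up to k, or the minimum m of A if there is none. *)
pose P (k : 'I_n.+1) a := (a \in A) && (a <= maxn k m)%N.
pose f k := [arg max_(a > m | P k a) val a]%N.
have fP k : P k (f k) /\ forall a, P k a -> (a <= f k)%N.
  by rewrite /f; case: arg_maxnP => //; rewrite /P mA leq_maxr.
have fm (j k : 'I_n.+1) : (j <= k)%N -> (f j <= f k)%N.
  move=> jk; apply: (fP k).2; have /andP[fA fj] := (fP j).1.
  rewrite /P fA; apply: leq_trans fj _.
  by rewrite geq_max leq_max jk leq_maxr.
exists (monotone fm); split=> [k|a aA]; first by have /andP[] := (fP k).1.
have /andP[_ fa] := (fP a).1; have := (fP a).2 a.
rewrite /P aA leq_maxl => /(_ isT) af; apply/val_inj/eqP.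
by rewrite eqn_leq af andbT /=; move: fa; rewrite (maxn_idPl (mmin _ aA)).
Qed.

Lemma simplex_support (R : realType) n (t : std_simplex R n) :
  exists i, coord t i != 0.
Proof.
apply: contrapT => nt; have := sum_coord t; rewrite big1 => [/esym/eqP|i _].
  by rewrite oner_eq0.
by apply/eqP; apply: contrapT => /negP ti; apply: nt; exists i.
Qed.

(** * Coefficient systems on a nerve and their coherent families *)

(** A covariant functor on the category of simplices of the nerve, which turns
    operators having a section into bijections. Transport along an operator
    takes the equation [s' = functor_comp s th] as an argument, which avoids
    casts along equalities of simplices. *)
Record coefficients (R : realType) (A : category) := Coefficients {
  car :> forall n, nerve A n -> topologicalType;
  tr : forall m n (s' : nerve A m) (s : nerve A n)
    (th : functor (ordcat m) (ordcat n)),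
    s' = functor_comp s th -> car s' -> car s;
  tr_continuous : forall m n (s' : nerve A m) (s : nerve A n) th
    (e : s' = functor_comp s th), continuous (tr e);
  tr_comp : forall l m n (s'' : nerve A l) (s' : nerve A m) (s : nerve A n)
    th ph ch (e1 : s'' = functor_comp s' ph) (e2 : s' = functor_comp s th)
    (e3 : s'' = functor_comp s ch) x,
    ch = functor_comp th ph -> tr e2 (tr e1 x) = tr e3 x;
  tr_id : forall n (s : nerve A n) th (e : s = functor_comp s th) x,
    th = functor_id _ -> tr e x = x;
  tr_section : forall m n (s' : nerve A m) (s : nerve A n) th sg
    (e : s' = functor_comp s th) (e' : s = functor_comp s' sg) x,
    is_section th sg -> tr e' (tr e x) = x }.

Section coherence.
Variables (R : realType) (A : category) (E : coefficients R A) (mu : gauge R).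

(** The real parameter of a family is the height in the prism. *)
Definition family := forall n (s : nerve A n), std_simplex R n * R -> E n s.

Definition coherent_at m n (s' : nerve A m) (s : nerve A n) th
    (e : s' = functor_comp s th) (f' : std_simplex R m * R -> E m s')
    (f : std_simplex R n * R -> E n s) :=
  forall t u, tr e (f' (t, u)) = f (push_simplex th t, u).

Variable f0 : family.
Hypothesis E_contractible : forall n (s : nerve A n), contractible R (E n s).
Hypothesis f0_continuous :
  forall n (s : nerve A n), {within [set z | mu z.2 = 0], continuous (f0 s)}.
Hypothesis f0_coherent : forall m n (s' : nerve A m) (s : nerve A n) th
  (e : s' = functor_comp s th) t u,
  mu u = 0 -> tr e (f0 s' (t, u)) = f0 s (push_simplex th t, u).

(** A partial family is encoded by its graph, so that inclusion is an order. *)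
Let entry := {n : nat & {s : nerve A n & std_simplex R n * R -> E n s}}.

Let ent n (s : nerve A n) (f : std_simplex R n * R -> E n s) : entry :=
  existT (fun n => {s : nerve A n & std_simplex R n * R -> E n s}) n
    (existT (fun s : nerve A n => std_simplex R n * R -> E n s) s f).

Record partial_family (G : set entry) : Prop := {
  pf_fun : forall n (s : nerve A n) f f',
    G (ent f) -> G (ent (s := s) f') -> f = f';
  pf_face : forall m n (s' : nerve A m) (s : nerve A n) th
    (e : s' = functor_comp s th) f, G (ent (s := s) f) ->
    exists2 f', G (ent (s := s') f') & coherent_at e f' f;
  pf_cont : forall n (s : nerve A n) f, G (ent (s := s) f) -> continuous f;
  pf_end : forall n (s : nerve A n) f, G (ent (s := s) f) ->
    forall z, mu z.2 = 0 -> f z = f0 s z }.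

Lemma chain_bigcup (F : set (set entry)) : F `<=` partial_family ->
  total_on F subset -> partial_family (\bigcup_(X in F) X).
Proof.
move=> FP Ftot; split.
- move=> n s f f' [X FX Xf] [Y FY Yf'].
  have [XY|YX] := Ftot _ _ FX FY.
    exact: (pf_fun (FP _ FY) (XY _ Xf) Yf').
  exact: (pf_fun (FP _ FX) Xf (YX _ Yf')).
- move=> m n s' s th e f [X FX Xf].
  have [f' Xf' ff'] := pf_face (FP _ FX) e Xf.
  by exists f' => //; exists X.
- by move=> n s f [X FX Xf]; exact: (pf_cont (FP _ FX) Xf).
- by move=> n s f [X FX Xf]; exact: (pf_end (FP _ FX) Xf).
Qed.

Let defined (G : set entry) n (s : nerve A n) := exists f, G (ent (s := s) f).

Lemma tr_injective m n (s' : nerve A m) (s : nerve A n) th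
  (e : s' = functor_comp s th) : (exists sg, is_section th sg) ->
  injective (tr e : E m s' -> E n s).
Proof.
move=> [sg thsg] x y; have e' : s = functor_comp s' sg.
  by rewrite e functor_compA thsg functor_comp_idr.
by move=> /(congr1 (tr e')); rewrite !(tr_section e e').
Qed.

Section extend.
Variables (G : set entry) (pG : partial_family G) (n : nat) (s : nerve A n).
Hypothesis s_new : ~ defined G s.
Hypothesis s_min : forall m (s' : nerve A m), (m < n)%N -> defined G s'.

Lemma defined_collapse i : (0 < n)%N -> defined G (functor_comp s (collapse i)).
Proof.
move=> n0.
have [m [ph [ps [mn cE]]]] : exists m, exists ph : functor (ordcat m) (ordcat n),
    exists ps : functor (ordcat n) (ordcat m),
    (m < n)%N /\ collapse i = functor_comp ph ps.
  clear -n0; case: n n0 i => // n' _ i.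
  by exists n', (face i), (degen i).
have [f Gf] := s_min (functor_comp s ph) mn.
have e : functor_comp s (collapse i) = functor_comp (functor_comp s ph) ps.
  by rewrite cE functor_compA.
by have [f' Gf' _] := pf_face pG e Gf; exists f'.
Qed.

Lemma defined_miss m (s' : nerve A m) th i :
  s' = functor_comp s th -> (forall k, th k <> i) -> defined G s'.
Proof.
move=> e thi; have [n0|n0] := posnP n.
  exfalso; apply: (thi ord0); move: (th ord0) (i).
  by rewrite n0 => j k; rewrite (ord1 j) (ord1 k).
have cth : functor_comp (collapse i) th = th.
  by apply: eq_ord_functor => a /=; rewrite collapse_fix //; exact/eqP/thi.
have e1 : s' = functor_comp (functor_comp s (collapse i)) th.
  by rewrite functor_compA cth.
have [f Gf] := defined_collapse i n0.
by have [f' Gf' _] := pf_face pG e1 Gf; exists f'.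
Qed.

(** An operator that is not surjective factors through a face of [s], on which
    the partial family is defined by minimality. *)
Lemma new_section m (s' : nerve A m) th :
  s' = functor_comp s th -> ~ defined G s' -> exists sg, is_section th sg.
Proof.
move=> e ns'; have [//|[i thi]] := section_or_miss th.
by case: ns'; exact: defined_miss e thi.
Qed.

(** The boundary values are forced: near a face, the value is transported from
    the collapse of the simplex onto this face. *)
Lemma fill_simplex : exists2 f : std_simplex R n * R -> E n s, continuous f &
  (forall z, mu z.2 = 0 -> f z = f0 s z) /\
  forall m (s' : nerve A m) th (e : s' = functor_comp s th) f',
    G (ent (s := s') f') -> coherent_at e f' f.
Proof.
have exE i : exists f : std_simplex R n * R -> E _ (functor_comp s (collapse i)),
    continuous f /\ ((0 < n)%N -> G (ent f)).
  have [n0|n0] := posnP n.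
    have [x0 _] := E_contractible (functor_comp s (collapse i)).
    by exists (cst x0); split=> [|//]; exact: cst_continuous.
  have [f Gf] := defined_collapse i n0.
  by exists f; split=> //; exact: (pf_cont pG Gf).
have [e_ eE] := fin_all_exists exE.
pose g i z := tr (erefl (functor_comp s (collapse i))) (e_ i z).
have n_gt0 i (z : std_simplex R n * R) : coord z.1 i = 0 -> (0 < n)%N.
  exact: coord0_pos.
have [|||f cf [ff0 fg]] := prism_extension (g := g)
  (E_contractible s) (@f0_continuous _ s).
- move=> i; apply: comp_continuous (eE i).1 _; exact: tr_continuous.
- move=> i [t u] /= m0 ti; have n0 := n_gt0 i (t, u) ti.
  rewrite /g (pf_end pG ((eE i).2 n0)) // f0_coherent //.
  by rewrite push_collapse.
- move=> i j [t u] /= ti tj; have n0 := n_gt0 i (t, u) ti.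
  pose S := [set k | coord t k != 0]%SET.
  have [a0 ta0] := simplex_support t.
  have a0S : a0 \in S by rewrite finset.inE.
  have [e [eS eid]] := retraction a0S.
  have et : push_simplex e t = t.
    by apply: push_fix => k tk; apply: eid; rewrite finset.inE.
  have ce k : coord t k = 0 -> functor_comp (collapse k) e = e.
    move=> tk; apply: eq_ord_functor => a /=; apply: collapse_fix.
    have := eS a; rewrite finset.inE; apply: contra_neq => eak.
    by rewrite eak.
  have faceE k (tk : coord t k = 0) : exists2 f,
      G (ent (s := functor_comp s e) f) &
      g k (t, u) = tr erefl (f (t, u)).
    have ek : functor_comp s e = functor_comp (functor_comp s (collapse k)) e.
      by rewrite functor_compA ce.
    have [f Gf ff] := pf_face pG ek ((eE k).2 n0); exists f => //.
    rewrite /g -{1}et -(ff t u); apply: tr_comp; exact/esym/ce.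
  have [f Gf ->] := faceE i ti; have [f' Gf' ->] := faceE j tj.
  by rewrite (pf_fun pG Gf Gf').
exists f => //; split=> // m s' th e f' Gf' t u.
have [[sg thsg]|[i thi]] := section_or_miss th.
  exfalso; apply: s_new; have e' : s = functor_comp s' sg.
    by rewrite e functor_compA thsg functor_comp_idr.
  by have [f'' Gf'' _] := pf_face pG e' Gf'; exists f''.
have ti : coord (push_simplex th t) i = 0.
  by rewrite coord_push big1 // => k /eqP /thi.
have cth : th = functor_comp (collapse i) th.
  apply: eq_ord_functor => a /=; rewrite collapse_fix //.
  exact/eqP/thi.
have e1 : s' = functor_comp (functor_comp s (collapse i)) th.
  by rewrite functor_compA -cth.
have n0 := n_gt0 i (push_simplex th t, u) ti.
have [f'' Gf'' ff''] := pf_face pG e1 ((eE i).2 n0).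
rewrite (fg i) // /g -ff'' (pf_fun pG Gf' Gf'').
exact/esym/tr_comp.
Qed.

(** Two degeneracies of the new simplex coincide only if the degeneracy
    operators do: otherwise a section of one of them that is not a section of
    the other exhibits the new simplex as a degeneracy of a proper face. *)
Lemma new_operator m (s' : nerve A m) (th th' : functor (ordcat m) (ordcat n)) :
  ~ defined G s' -> s' = functor_comp s th -> s' = functor_comp s th' ->
  th = th'.
Proof.
move=> ns' e e'; apply: eq_ord_functor => i.
have [sg0 thsg0] := new_section e ns'.
have surj j : exists i, th i = j.
  exists (sg0 j); rewrite -[RHS]/(functor_id (ordcat n) j) -thsg0.
  by [].
have [sg thsg sgi] := surj_section i surj.
have es : s = functor_comp s (functor_comp th' sg).
  by rewrite -functor_compA -e' e functor_compA thsg functor_comp_idr.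
have := monotone_endo_id (new_section es s_new) (th i).
by rewrite /= sgi.
Qed.

Let added m (s' : nerve A m) (f' : std_simplex R m * R -> E m s')
    (f : std_simplex R n * R -> E n s) :=
  [/\ ~ defined G s', continuous f',
      (forall z, mu z.2 = 0 -> f' z = f0 s' z) &
      exists th (e : s' = functor_comp s th), coherent_at e f' f].

(** All the degeneracies of [s] have to be adjoined together with [s], and their
    values are determined by the value at [s] since their transports to [s] are
    injective. *)
Lemma extend_partial_family : exists2 G', G `<` G' & partial_family G'.
Proof.
have [f cf [ff0 fG]] := fill_simplex.
pose G' : set entry := [set x | G x \/ added (projT2 (projT2 x)) f].
have G'E m (s' : nerve A m) f' : G' (ent (s := s') f') ->
    G (ent f') \/ added f' f by [].
have face m (s' : nerve A m) th (e : s' = functor_comp s th) :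
    exists2 f', G' (ent f') & coherent_at e f' f.
  have [[f' Gf']|ns'] := pselect (defined G s').
    by exists f'; [left|exact: fG].
  have sec := new_section e ns'; have [sg thsg] := sec.
  have e' : s = functor_comp s' sg.
    by rewrite e functor_compA thsg functor_comp_idr.
  pose f' z := tr e' (f (push_simplex th z.1, z.2)).
  have ff' : coherent_at e f' f.
    move=> t u; rewrite /f' (tr_comp e' e (esym (functor_comp_idr s))) ?thsg //.
    exact: tr_id.
  exists f' => //; right; split=> //.
  - apply: (comp_continuous _ (@tr_continuous _ _ E _ _ _ _ _ e')).
    apply: comp_continuous cf; apply: pair_continuous => [z|z].
      apply: (@comp_continuous _ _ _ fst (push_simplex th)) => [y|].
        exact: cvg_fst.
      exact: push_continuous.
    exact: cvg_snd.
  - move=> [t u] m0; apply: (@tr_injective m n s' s th e sec) => /=.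
    by rewrite ff' ff0 // f0_coherent.
  - by exists th, e.
exists G'; first split.
- by left.
- move=> G'G; apply: s_new; have [f' G'f' _] := face _ s _ (esym (functor_comp_idr s)).
  by exists f'; exact: G'G.
split.
- move=> m s' f1 f2 H1 H2.
  case: (G'E m s' f1 H1) => [G1|[n1 _ _ [th1 [e1 c1]]]];
    case: (G'E m s' f2 H2) => [G2|[n2 _ _ [th2 [e2 c2]]]].
  + exact: (pf_fun pG G1 G2).
  + by case: n2; exists f1.
  + by case: n1; exists f2.
  + have thE := new_operator n1 e1 e2; subst th2.
    apply/funext => -[t u]; apply: (@tr_injective m n s' s th1 e1 (new_section e1 n1)).
    rewrite c1 (Prop_irrelevance e1 e2) in c2 *.
    by rewrite c2.
- move=> l m s'' s' ph e1 f' H; case: (G'E m s' f' H) => [Gf'|[ns' _ _ [th [e c]]]].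
    have [f'' Gf'' c''] := pf_face pG e1 Gf'.
    by exists f'' => //; left.
  have e2 : s'' = functor_comp s (functor_comp th ph).
    by rewrite e1 e functor_compA.
  have [f'' Gf'' c''] := face _ _ _ e2; exists f'' => // t u.
  apply: (@tr_injective m n s' s th e (new_section e ns')).
  by rewrite (tr_comp e1 e e2) // c'' c push_comp.
- by move=> m s' f' H; case: (G'E m s' f' H) => [/(pf_cont pG)|[]].
- by move=> m s' f' H; case: (G'E m s' f' H) => [/(pf_end pG)|[]].
Qed.

End extend.

(** A family of maps from prisms to contractible spaces can be prescribed on
    the zero set of the gauge: a maximal partial family is defined everywhere,
    as it could be extended to an undefined simplex of minimal dimension. *)
Theorem coherent_family : exists f : family,
  [/\ forall n (s : nerve A n), continuous (f n s),
      forall m n (s' : nerve A m) (s : nerve A n) th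
        (e : s' = functor_comp s th), coherent_at e (f m s') (f n s) &
      forall n (s : nerve A n) z, mu z.2 = 0 -> f n s z = f0 s z].
Proof.
have [G [pG Gmax]] := Zorn_bigcup chain_bigcup.
have total n (s : nerve A n) : defined G s.
  apply: contrapT => ns.
  have ex : exists n, `[< exists s : nerve A n, ~ defined G s >].
    by exists n; apply/asboolP; exists s.
  case: (ex_minnP ex) => m /asboolP[s' ns'] mmin.
  have [|G' GG' pG'] := @extend_partial_family G pG m s' ns'; last exact: (Gmax _ GG').
  move=> k s'' km; apply: contrapT => ns''.
  have : (m <= k)%N by apply: mmin; apply/asboolP; exists s''.
  by rewrite leqNgt km.
pose f : family := fun n s => projT1 (cid (total n s)).
have Gf n (s : nerve A n) : G (ent (f n s)) := projT2 (cid (total n s)).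
exists f; split.
- by move=> n s; exact: (pf_cont pG (Gf n s)).
- move=> m n s' s th e; have [f' Gf' c] := pf_face pG e (Gf n s).
  by rewrite (pf_fun pG (Gf m s') Gf').
- by move=> n s; exact: (pf_end pG (Gf n s)).
Qed.

End coherence.

(** * Existence and uniqueness of coherent maps *)

Program Definition trivial_gauge (R : realType) : gauge R :=
  @Gauge R (cst 1) (cst 0) _ _ _ _.
Next Obligation. by move=> R; exact: cst_continuous. Qed.
Next Obligation. by move=> R; exact: cst_continuous. Qed.
Next Obligation. by move=> R u; exact: ler01. Qed.
Next Obligation. by move=> R u; rewrite /= ltxx. Qed.

Definition tent (R : realType) (u : R) : R :=
  Num.max 0 (Num.min (u + u) (2 - (u + u))).

Lemma tent_eq0 (R : realType) (u : R) : tent u = 0 <-> u <= 0 \/ 1 <= u.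
Proof.
by rewrite /tent /Num.max /Num.min; split=> [|[]];
  case: (ltP (u + u)) => h1; case: ltP => h2; try lra; move=> h3; try lra;
  (try by [left; lra|right; lra]).
Qed.

Lemma tent_continuous (R : realType) : continuous (@tent R).
Proof.
have c2 : continuous (fun u : R => u + u).
  by move=> u; apply: (@cvgD _ R); exact: cvg_id.
move=> u; apply: (@continuous_max R R (cst 0)
  (fun v : R => Num.min (v + v) (2 - (v + v)))); first exact: cst_continuous.
apply: (@continuous_min R R (fun v : R => v + v)); first exact: c2.
by apply: (@cvgB _ R); [exact: cvg_cst|exact: c2].
Qed.

Program Definition tent_gauge (R : realType) : gauge R :=
  @Gauge R (@tent R) (cst (1 / 2)) (@tent_continuous R) _ _ _.
Next Obligation. by move=> R; exact: cst_continuous. Qed.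
Next Obligation. by move=> R u; rewrite /tent le_max lexx. Qed.
Next Obligation.
move=> R u /= u1.
have [t0|/eqP t0] := eqVneq (tent u) 0.
  by rewrite t0 mul0r !subr0 divr1 t0.
have [e|e] : tent u = u + u \/ tent u = 2 - (u + u).
  move: t0; rewrite /tent /Num.max /Num.min.
  by case: (ltP (u + u)) => h1; case: ltP => h2 //; [left|right].
- suff -> : (u - tent u * (1 / 2)) / (1 - tent u) = 0.
    by apply/tent_eq0; left.
  by rewrite e (_ : u - (u + u) * (1 / 2) = 0) ?mul0r //; lra.
- suff -> : (u - tent u * (1 / 2)) / (1 - tent u) = 1.
    by apply/tent_eq0; right.
  rewrite e; apply/eqP; rewrite -subr_eq0; apply/eqP; field.
  by rewrite e in u1; apply/eqP; lra.
Qed.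

Section coherent_maps.
Variables (R : realType) (A : category) (E : coefficients R A).
Hypothesis E_contractible : forall n (s : nerve A n), contractible R (E n s).

Definition coherent_map (f : forall n (s : nerve A n), std_simplex R n -> E n s) :=
  (forall n (s : nerve A n), continuous (f n s)) /\
  forall m n (s' : nerve A m) (s : nerve A n) th (e : s' = functor_comp s th) t,
    tr e (f m s' t) = f n s (push_simplex th t).

Lemma coherent_map_exists : exists f, coherent_map f.
Proof.
pose f0 : family E := fun n s => cst (projT1 (cid (E_contractible s))).
have [|m n s' s th e t u m0|f [cf ff _]] := coherent_family (mu := trivial_gauge R)
  (f0 := f0) E_contractible.
- by move=> n s; apply: continuous_subspaceT; exact: cst_continuous.
- by move: m0 => /= /eqP; rewrite oner_eq0.
exists (fun n s t => f n s (t, 0)); split=> [n s|m n s' s th e t].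
  apply: (comp_continuous _ (cf n s)); apply: pair_continuous => [x|].
    exact: cvg_id.
  exact: cst_continuous.
exact: ff.
Qed.

(** The two coherent maps are prescribed at the two ends of a family of prisms,
    and the homotopies obtained in the carriers are glued by the maps [q]. *)
Lemma homotopic_coherent (Y : topologicalType)
    (q : forall n (s : nerve A n), E n s -> Y)
    (a b : forall n (s : nerve A n), std_simplex R n -> E n s)
    (f g : realization R A -> Y) :
  (forall n (s : nerve A n), continuous (q n s)) ->
  (forall m n (s' : nerve A m) (s : nerve A n) th (e : s' = functor_comp s th) x,
     q n s (tr e x) = q m s' x) ->
  coherent_map a -> coherent_map b ->
  (forall n (s : nerve A n) t, f (pt s t) = q n s (a n s t)) ->
  (forall n (s : nerve A n) t, g (pt s t) = q n s (b n s t)) ->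
  homotopic R f g.
Proof.
move=> cq qE [ca aE] [cb bE] fE gE.
(* Only the values at heights outside ]0, 1[ matter. *)
pose f0 : family E := fun n s z => if z.2 < 1 / 2 then a n s z.1 else b n s z.1.
have [|m n s' s th e t u _|k [ck kE k0]] := coherent_family (mu := tent_gauge R)
  (f0 := f0) E_contractible.
- move=> n s; apply/subspace_continuousP => -[t u] /= /tent_eq0 u01.
  apply: cvg_within_filter; suff : {for (t, u), continuous (f0 n s)} by [].
  have csnd : continuous (fun z : std_simplex R n * R => z.2).
    by move=> z; exact: cvg_snd.
  have [{}u01|{}u01] : u < 1 / 2 \/ 1 / 2 < u by case: u01 => ?; [left|right]; lra.
    apply: (@continuous_near _ _ (fun z => a n s z.1)).
      have nl := csnd (t, u) [set y | y < 1 / 2] (lt_nbhsl u01).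
      by apply: (@filterS _ (nbhs (t, u)) _ _ _ _ nl) => y /= yl; rewrite /f0 yl.
    apply: (@comp_continuous _ _ _ fst) => [y|]; first exact: cvg_fst.
    exact: ca.
  apply: (@continuous_near _ _ (fun z => b n s z.1)).
    have nl := csnd (t, u) [set y | 1 / 2 < y] (lt_nbhsr u01).
    apply: (@filterS _ (nbhs (t, u)) _ _ _ _ nl) => y /= yl.
    by rewrite /f0 ltNge (ltW yl).
  apply: (@comp_continuous _ _ _ fst) => [y|]; first exact: cvg_fst.
  exact: cb.
- by rewrite /f0 /=; case: ifP => _; [exact: aE|exact: bE].
have [||h ch hE] := @realization_homotopy R A Y (fun n s z => q n s (k n s z)).
- by move=> n s; exact: comp_continuous (ck n s) (cq n s).
- by move=> m n th s t u; rewrite -(kE _ _ _ _ _ erefl) qE.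
apply/homotopicP; exists h; split=> //.
- move=> + u u0; apply: realization_ind => n s t.
  rewrite hE fE k0 /=; last by apply/tent_eq0; left.
  by rewrite /f0 /= (_ : u < 1 / 2) //; lra.
- move=> + u u1; apply: realization_ind => n s t.
  rewrite hE gE k0 /=; last by apply/tent_eq0; right.
  by rewrite /f0 /= (_ : u < 1 / 2 = false) //; lra.
Qed.

End coherent_maps.

(** * Categories with a terminal object are contractible *)

Definition arrow n (i j : 'I_n.+1) : mor (ordcat n) :=
  insubd (ord_arrow (leqnn i)) (i, j).

Lemma val_arrow n (i j : 'I_n.+1) : (i <= j)%N -> val (arrow i j) = (i, j).
Proof. by move=> ij; rewrite val_insubd ij. Qed.

Lemma dom_arrow n (i j : 'I_n.+1) : (i <= j)%N -> dom (arrow i j) = i.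
Proof. by move=> ij; rewrite /= val_arrow. Qed.

Lemma cod_arrow n (i j : 'I_n.+1) : (i <= j)%N -> cod (arrow i j) = j.
Proof. by move=> ij; rewrite /= val_arrow. Qed.

Lemma mcomp_arrow n (i j k : 'I_n.+1) e : (i <= j)%N -> (j <= k)%N ->
  mcomp (arrow j k) (arrow i j) e = arrow i k.
Proof.
move=> ij jk; apply: val_inj => /=.
by rewrite !val_arrow // (leq_trans ij jk).
Qed.

Lemma fmor_arrow m n (th : functor (ordcat m) (ordcat n)) (a b : 'I_m.+1) :
  (a <= b)%N -> fmor th (arrow a b) = arrow (th a) (th b).
Proof.
move=> ab; apply: val_inj; rewrite val_arrow; last exact: ordcat_monotone.
rewrite [LHS]surjective_pairing; congr pair.
  exact: etrans (fdom _ _) (congr1 th (dom_arrow ab)).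
exact: etrans (fcod _ _) (congr1 th (cod_arrow ab)).
Qed.

Section terminal.
Variables (R : realType) (K : category) (top : ob K) (bang : ob K -> mor K).
Hypothesis dom_bang : forall x, dom (bang x) = x.
Hypothesis cod_bang : forall x, cod (bang x) = top.
Hypothesis bang_comp : forall f e, mcomp (bang (cod f)) f e = bang (dom f).

(** The simplex [s] extended by the terminal object as a new last vertex. *)
Section join.
Variables (n : nat) (s : nerve K n).

Definition join_ob (i : 'I_n.+2) : ob K :=
  if unlift ord_max i is Some a then s a else top.

Definition join_mor (f : mor (ordcat n.+1)) : mor K :=
  match unlift ord_max (dom f), unlift ord_max (cod f) with
  | Some a, Some b => fmor s (arrow a b)
  | Some a, None => bang (s a)
  | None, _ => idm top
  end.

Lemma join_morE (h : mor (ordcat n.+1)) i j : dom h = i -> cod h = j ->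
  join_mor h = match unlift ord_max i, unlift ord_max j with
    | Some a, Some b => fmor s (arrow a b)
    | Some a, None => bang (s a)
    | None, _ => idm top end.
Proof. by move=> <- <-. Qed.

Lemma join_arrow (f : mor (ordcat n.+1)) :
  [\/ exists a b : 'I_n.+1,
       [/\ (a <= b)%N, dom f = lift ord_max a & cod f = lift ord_max b],
      exists a : 'I_n.+1, dom f = lift ord_max a /\ cod f = ord_max |
      dom f = ord_max /\ cod f = ord_max].
Proof.
have := valP f; rewrite -[(val f).1]/(dom f) -[(val f).2]/(cod f).
case: (unliftP ord_max (dom f)) => [a|] ->; case: (unliftP ord_max (cod f)) => [b|] ->.
- by rewrite leq_bump2 => ab; apply: Or31; exists a, b.
- by move=> _; apply: Or32; exists a.
- by rewrite lift_max leqNgt ltn_ord.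
- by move=> _; apply: Or33.
Qed.

Program Definition join : nerve K n.+1 :=
  @Functor (ordcat n.+1) K join_ob join_mor _ _ _ _.
Next Obligation.
move=> f; rewrite /join_mor /join_ob.
have [[a [b [ab -> ->]]]|[a [-> ->]]|[-> ->]] := join_arrow f;
  rewrite ?liftK ?unlift_none ?dom_idm //.
by rewrite fdom dom_arrow.
Qed.
Next Obligation.
move=> f; rewrite /join_mor /join_ob.
have [[a [b [ab -> ->]]]|[a [-> ->]]|[-> ->]] := join_arrow f;
  rewrite ?liftK ?unlift_none ?cod_idm //.
by rewrite fcod cod_arrow.
Qed.
Next Obligation.
move=> x; rewrite /join_mor /join_ob /=.
case: unliftP => [a _|_] //; rewrite -fidm; congr fmor; apply: val_inj.
by rewrite val_arrow.
Qed.
Next Obligation.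
move=> g f e e'.
have some_none (a : 'I_n.+1) : lift ord_max a <> ord_max.
  by move=> h; have := neq_lift ord_max a; rewrite h eqxx.
have [[a [b [ab fd fc]]]|[a [fd fc]]|[fd fc]] := join_arrow f;
have [[b' [c [bc gd gc]]]|[b' [gd gc]]|[gd gc]] := join_arrow g;
  have efg := etrans (esym gd) (etrans e fc);
  try (by case: (some_none _ efg)); try (by case: (some_none _ (esym efg)));
  rewrite (@join_morE (mcomp g f e) _ _ (etrans (dom_mcomp _) fd)
    (etrans (cod_mcomp _) gc));
  have jf := join_morE fd fc; have jg := join_morE gd gc;
  move: jf jg; rewrite ?liftK ?unlift_none => jf jg.
- have bb : b' = b by exact: lift_inj efg.
  subst b'; have e1 : dom (arrow b c) = cod (arrow a b).
    by rewrite dom_arrow ?cod_arrow.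
  have e2 : dom (fmor s (arrow b c)) = cod (fmor s (arrow a b)).
    by rewrite fdom fcod e1.
  rewrite -(mcomp_arrow e1 ab bc) (fcomp e1 e2); exact: eq_comp.
- have bb : b' = b by exact: lift_inj efg.
  subst b'; have sb : s b = cod (fmor s (arrow a b)) by rewrite fcod cod_arrow.
  have sa : s a = dom (fmor s (arrow a b)) by rewrite fdom dom_arrow.
  have e1 : dom (bang (cod (fmor s (arrow a b)))) = cod (fmor s (arrow a b)).
    exact: dom_bang.
  rewrite sa -(bang_comp e1); apply: eq_comp => //.
  by rewrite jg sb.
- have e1 : dom (idm (cod (bang (s a)))) = cod (bang (s a)) by rewrite dom_idm.
  rewrite -[LHS](mcomp_idl e1); apply: eq_comp => //.
  by rewrite jg cod_bang.
- have e1 : dom (idm (cod (idm top))) = cod (idm top) by rewrite dom_idm.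
  rewrite -[LHS](mcomp_idl e1); apply: eq_comp => //.
  by rewrite jg cod_idm.
Qed.

End join.

Definition join_fun m n (f : 'I_m.+1 -> 'I_n.+1) (i : 'I_m.+2) : 'I_n.+2 :=
  if unlift ord_max i is Some a then lift ord_max (f a) else ord_max.

Lemma join_fun_monotone m n (th : functor (ordcat m) (ordcat n))
    (i j : 'I_m.+2) : (i <= j)%N -> (join_fun th i <= join_fun th j)%N.
Proof.
rewrite /join_fun.
case: (unliftP ord_max i) => [a|] ->; case: (unliftP ord_max j) => [b|] ->.
- by rewrite !leq_bump2; exact: ordcat_monotone.
- by move=> _; rewrite leq_ord.
- by rewrite lift_max leqNgt ltn_ord.
- by [].
Qed.

Definition join_op m n (th : functor (ordcat m) (ordcat n)) :
    functor (ordcat m.+1) (ordcat n.+1) :=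
  monotone (join_fun_monotone th).

Lemma join_comp m n (s : nerve K n) (th : functor (ordcat m) (ordcat n)) :
  join (functor_comp s th) = functor_comp (join s) (join_op th).
Proof.
have obE i : join (functor_comp s th) i = functor_comp (join s) (join_op th) i.
  by rewrite /= /join_ob /join_fun; case: (unliftP ord_max i) => [a|] _;
    rewrite ?liftK ?unlift_none.
apply: eq_functor => // f.
have Jd (i : 'I_m.+2) : dom f = i ->
  dom (fmor (join_op th) f) = join_op th i by move=> <-; exact: fdom.
have Jc (i : 'I_m.+2) : cod f = i ->
  cod (fmor (join_op th) f) = join_op th i by move=> <-; exact: fcod.
rewrite -[LHS]/(join_mor _ f) -[RHS]/(join_mor s (fmor (join_op th) f)).
have [[a [b [ab fd fc]]]|[a [fd fc]]|[fd fc]] := join_arrow f;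
  rewrite (join_morE _ fd fc) (join_morE _ (Jd _ fd) (Jc _ fc)) /= /join_fun
    ?liftK ?unlift_none ?liftK //.
by rewrite fmor_arrow.
Qed.

(** The point at height [u] on the segment joining a point to the apex. *)
Lemma cone_pt_subproof n (t : std_simplex R n) (u : R) :
  (\row_i (if unlift ord_max i is Some a then (1 - clamp u) * coord t a
           else clamp u)) \in std_simplex R n.+1.
Proof.
have := clamp_itv u; rewrite /= in_itv /= => /andP[u0 u1].
apply/mem_set; split=> [i|].
  rewrite mxE; case: unliftP => [a _|_] //.
  by rewrite mulr_ge0 ?coord_ge0 // subr_ge0.
under eq_bigr do rewrite mxE.
rewrite big_ord_recr /= unlift_none.
under eq_bigr => i _.
  rewrite (_ : widen_ord _ i = lift ord_max i); last first.
    by apply: val_inj; rewrite /= /bump leqNgt ltn_ord.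
  rewrite liftK; over.
by rewrite -mulr_sumr sum_coord mulr1 subrK.
Qed.

Definition cone_pt n (z : std_simplex R n * R) : std_simplex R n.+1 :=
  exist (fun u => u \in std_simplex R n.+1) _ (cone_pt_subproof z.1 z.2).

Lemma coord_cone_pt n (z : std_simplex R n * R) i : coord (cone_pt z) i =
  if unlift ord_max i is Some a then (1 - clamp z.2) * coord z.1 a
  else clamp z.2.
Proof. by rewrite /coord mxE. Qed.

Lemma cone_pt_continuous n : continuous (@cone_pt n).
Proof.
have cc : continuous (fun z : std_simplex R n * R => clamp z.2).
  apply: (@comp_continuous _ _ _ snd) => [y|]; first exact: cvg_snd.
  exact: clamp_continuous.
move=> z; apply: simplex_continuous => i.
suff : continuous (fun z : std_simplex R n * R =>
    if unlift ord_max i is Some a then (1 - clamp z.2) * coord z.1 a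
    else clamp z.2).
  move=> /(_ z); rewrite (_ : (fun _ => _) = (fun z => coord (cone_pt z) i)) //.
  by apply/funext => y; rewrite coord_cone_pt.
case: unliftP => [a _|_] //.
move=> y; apply: (@cvgM R).
  by apply: (@cvgB _ R); [exact: cvg_cst|exact: cc].
apply: (@comp_continuous _ _ R fst (fun t : std_simplex R n => coord t a)) => [x|].
  exact: cvg_fst.
exact: coord_continuous.
Qed.

Lemma push_cone_pt m n (th : functor (ordcat m) (ordcat n))
    (t : std_simplex R m) u :
  push_simplex (join_op th) (cone_pt (t, u)) = cone_pt (push_simplex th t, u).
Proof.
have jm : join_op th ord_max = ord_max by rewrite /= /join_fun unlift_none.
have jl a : join_op th (lift ord_max a) = lift ord_max (th a).
  by rewrite /= /join_fun liftK.
apply: eq_simplex => j; rewrite coord_push coord_cone_pt [fst _]/= [snd _]/=.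
rewrite big_mkcond big_ord_recr jm.
under eq_bigr => i _.
  rewrite (_ : widen_ord _ i = lift ord_max i); last first.
    by apply: val_inj; rewrite /= /bump leqNgt ltn_ord.
  rewrite jl coord_cone_pt liftK [fst _]/= [snd _]/=; over.
rewrite coord_cone_pt unlift_none [snd _]/=.
case: (unliftP ord_max j) => [b|] ->.
  rewrite (negbTE (neq_lift _ _)) Monoid.mulm1 coord_push mulr_sumr.
  rewrite [RHS]big_mkcond; apply: eq_bigr => i _.
  by rewrite (inj_eq lift_inj).
rewrite eqxx big1 ?Monoid.mul1m // => i _.
by rewrite eq_sym (negbTE (neq_lift _ _)).
Qed.

Program Definition top_simplex n : nerve K n :=
  @Functor (ordcat n) K (fun=> top) (fun=> idm top) _ _ _ _.
Next Obligation. by move=> n f; rewrite dom_idm. Qed.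
Next Obligation. by move=> n f; rewrite cod_idm. Qed.
Next Obligation. by []. Qed.
Next Obligation.
move=> n g f e e'.
have e1 : dom (idm (cod (idm top))) = cod (idm top) by rewrite dom_idm.
by rewrite -[LHS](mcomp_idl e1); apply: eq_comp => //; rewrite cod_idm.
Qed.

(** Every point moves on a straight line to the apex of the cone over its
    simplex. The apices are vertices carrying the same object, so they represent
    the same point. *)
Theorem terminal_contractible : contractible R (realization R K).
Proof.
have one_in : (\row_i 1 : 'rV[R]_1) \in std_simplex R 0.
  apply/mem_set; split=> [i|]; first by rewrite mxE.
  by rewrite big_ord_recl big_ord0 mxE addr0.
pose t0 : std_simplex R 0 := exist (fun u => u \in std_simplex R 0) _ one_in.
exists (pt (top_simplex 0) t0).
have topE n (t : std_simplex R n) : pt (top_simplex n) t = pt (top_simplex 0) t0.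
  have cm (i j : 'I_n.+1) : (i <= j)%N -> ((ord0 : 'I_1) <= (ord0 : 'I_1))%N by [].
  have -> : top_simplex n = functor_comp (top_simplex 0) (monotone cm).
    exact: eq_functor.
  rewrite pt_glue; congr pt; apply: eq_simplex => i.
  rewrite coord_push (ord1 i) -[RHS]/((\row_i 1 : 'rV[R]_1) ord0 ord0) mxE.
  by rewrite -(sum_coord t); apply: eq_bigl.
have [||h ch hE] := @realization_homotopy R K (realization R K)
    (fun n s z => pt (join s) (cone_pt z)).
- move=> n s; apply: comp_continuous (@cone_pt_continuous n) _.
  exact: pt_continuous.
- by move=> m n th s t u; rewrite join_comp pt_glue push_cone_pt.
apply/homotopicP; exists h; split=> //.
- move=> + u u0; apply: realization_ind => n s t; rewrite hE.
  have -> : cone_pt (t, u) = push_simplex (face ord_max) t.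
    apply: eq_simplex => i; rewrite coord_cone_pt coord_push /= clamp_le0 //.
    rewrite subr0; case: (unliftP ord_max i) => [a|] ->.
      rewrite mul1r (big_pred1 a) // => j.
      by rewrite /= (inj_eq lift_inj).
    rewrite big_pred0 // => j.
    by rewrite eq_sym (negbTE (neq_lift _ _)).
  rewrite -pt_glue; congr pt.
  have obE i : functor_comp (join s) (face ord_max) i = s i.
    by rewrite /= /join_ob liftK.
  apply: eq_functor => // f.
  rewrite [LHS]/= -[LHS]/(join_mor s (fmor (face ord_max) f)).
  rewrite (join_morE s (fdom (face ord_max) f) (fcod (face ord_max) f)) /= !liftK.
  congr fmor; apply: val_inj; rewrite val_arrow; last exact: (valP f).
  by rewrite [RHS]surjective_pairing.
- move=> + u u1; apply: realization_ind => n s t; rewrite hE -(topE n.+1 (cone_pt (t, u))).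
  have cm (i j : 'I_n.+2) : (i <= j)%N ->
    ((ord_max : 'I_n.+2) <= (ord_max : 'I_n.+2))%N by [].
  have {1}-> : cone_pt (t, u) = push_simplex (monotone cm) (cone_pt (t, u)).
    rewrite push_fix // => i; rewrite coord_cone_pt /= clamp_ge1 // subrr.
    by case: unliftP => // a _; rewrite mul0r eqxx.
  rewrite -pt_glue; congr pt.
  apply: eq_functor => [i|f]; first by rewrite /= /join_ob unlift_none.
  rewrite -[LHS]/(join_mor s (fmor (monotone cm) f)).
  by rewrite (join_morE s (fdom (monotone cm) f) (fcod (monotone cm) f)) /= unlift_none.
Qed.

End terminal.

(** * The slices of a functor as a coefficient system *)

Section over_push.
Variables (B D : category) (Q : functor B D) (f : mor D) (d d' : ob D).
Hypotheses (fd : dom f = d) (fc : cod f = d').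

Lemma over_push_composable (x : over_ob Q d) : dom f = cod (ov_map x).
Proof. by rewrite fd ov_cod. Qed.

Program Definition over_push_ob (x : over_ob Q d) : over_ob Q d' :=
  @OverOb B D Q d' (ov_ob x) (mcomp f (ov_map x) (over_push_composable x)) _ _.
Next Obligation. by move=> x; rewrite dom_mcomp ov_dom. Qed.
Next Obligation. by move=> x; rewrite cod_mcomp. Qed.

Program Definition over_push_mor (h : over_mor Q d) : over_mor Q d' :=
  @OverMor B D Q d' (over_push_ob (ov_src h)) (over_push_ob (ov_tgt h))
    (ov_mor h) (ov_mor_dom h) (ov_mor_cod h) _.
Next Obligation.
move=> h; have [e E] := ov_mor_eq h.
have e1 : dom (mcomp f (ov_map (ov_tgt h)) (over_push_composable (ov_tgt h))) =
    cod (fmor Q (ov_mor h)) by rewrite dom_mcomp.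
exists e1 => /=.
have e2 : dom f = cod (mcomp (ov_map (ov_tgt h)) (fmor Q (ov_mor h)) e).
  by rewrite cod_mcomp fd ov_cod.
rewrite -(mcompA e2 e1); exact: eq_comp.
Qed.

Program Definition over_push : functor (overcat Q d) (overcat Q d') :=
  @Functor (overcat Q d) (overcat Q d') over_push_ob over_push_mor
    (fun=> erefl) (fun=> erefl) _ _.
Next Obligation. by move=> x; apply: over_mor_eq. Qed.
Next Obligation. by move=> g h e e'; apply: over_mor_eq => //=; exact: eq_comp. Qed.

End over_push.

Lemma over_push_id (B D : category) (Q : functor B D) (f : mor D) (d : ob D)
    (fd : dom f = d) (fc : cod f = d) :
  f = idm d -> over_push Q fd fc = functor_id _.
Proof.
move=> fE; have obE x : over_push Q fd fc x = x.
  apply: over_ob_eq => //=.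
  have e : dom (idm (cod (ov_map x))) = cod (ov_map x) by rewrite dom_idm.
  by rewrite -[RHS](mcomp_idl e); apply: eq_comp => //; rewrite fE ov_cod.
by apply: eq_functor => // h; apply: over_mor_eq => //=; exact: obE.
Qed.

Lemma over_push_comp (B D : category) (Q : functor B D) (f g h : mor D)
    (d d' d'' : ob D) (fd : dom f = d) (fc : cod f = d') (gd : dom g = d')
    (gc : cod g = d'') (hd : dom h = d) (hc : cod h = d'') e :
  h = mcomp g f e ->
  functor_comp (over_push Q gd gc) (over_push Q fd fc) = over_push Q hd hc.
Proof.
move=> hE; have obE x :
    functor_comp (over_push Q gd gc) (over_push Q fd fc) x = over_push Q hd hc x.
  apply: over_ob_eq => //=.
  have e1 : dom (mcomp g f e) = cod (ov_map x) by rewrite dom_mcomp fd ov_cod.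
  have e2 : dom g = cod (mcomp f (ov_map x) (over_push_composable fd x)).
    by rewrite cod_mcomp.
  transitivity (mcomp (mcomp g f e) (ov_map x) e1); last exact: eq_comp.
  by rewrite -(mcompA e2 e1); apply: eq_comp.
by apply: eq_functor => // k; apply: over_mor_eq => //=; exact: obE.
Qed.

Program Definition over_forget (B D : category) (Q : functor B D) (d : ob D) :
    functor (overcat Q d) B :=
  @Functor (overcat Q d) B (@ov_ob B D Q d) (@ov_mor B D Q d)
    (@ov_mor_dom B D Q d) (@ov_mor_cod B D Q d) (fun=> erefl) _.
Next Obligation. by move=> B D Q d g h e e'; exact: eq_comp. Qed.

Lemma over_forget_push (B D : category) (Q : functor B D) (f : mor D)
    (d d' : ob D) (fd : dom f = d) (fc : cod f = d') :
  functor_comp (over_forget Q d') (over_push Q fd fc) = over_forget Q d.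
Proof. exact: eq_functor. Qed.

Lemma eq_ord_mor n (f g : mor (ordcat n)) : dom f = dom g -> cod f = cod g -> f = g.
Proof.
move=> ed ec; apply: val_inj.
by rewrite [LHS]surjective_pairing [RHS]surjective_pairing; congr pair.
Qed.

Definition last_arrow m n (th : functor (ordcat m) (ordcat n)) :
    mor (ordcat n) :=
  @ord_arrow n (th ord_max) ord_max (leq_ord (th ord_max)).

Section slices.
Variables (R : realType) (A B D : category) (P : functor A D) (Q : functor B D).

(** The carrier of a simplex of A is the slice of Q over the image of its last
    vertex. An operator moves the last vertex along an arrow of the simplex, and
    composition with this arrow transports slices; a surjective operator
    preserves the last vertex. *)
Definition slice n (s : nerve A n) : topologicalType :=
  realization R (overcat Q (P (s ord_max))).

Definition slice_arrow m n (s : nerve A n)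
  (th : functor (ordcat m) (ordcat n)) : mor D :=
  fmor P (fmor s (last_arrow th)).

Lemma slice_arrow_dom m n (s' : nerve A m) (s : nerve A n) th :
  s' = functor_comp s th -> dom (slice_arrow s th) = P (s' ord_max).
Proof. by move=> ->; rewrite /slice_arrow !fdom. Qed.

Lemma slice_arrow_cod m n (s : nerve A n) (th : functor (ordcat m) (ordcat n)) :
  cod (slice_arrow s th) = P (s ord_max).
Proof. by rewrite /slice_arrow !fcod. Qed.

Definition slice_functor m n (s' : nerve A m) (s : nerve A n) th
    (e : s' = functor_comp s th) :
    functor (overcat Q (P (s' ord_max))) (overcat Q (P (s ord_max))) :=
  over_push Q (slice_arrow_dom e) (slice_arrow_cod s th).

Definition slice_tr m n (s' : nerve A m) (s : nerve A n) th
  (e : s' = functor_comp s th) : slice s' -> slice s := realize (slice_functor e).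

Lemma slice_arrow_id m n (s : nerve A n) (th : functor (ordcat m) (ordcat n)) :
  th ord_max = ord_max -> slice_arrow s th = idm (P (s ord_max)).
Proof.
move=> thm; rewrite /slice_arrow -!fidm; congr (fmor P (fmor s _)).
by apply: val_inj; rewrite /= thm.
Qed.

Program Definition slices : coefficients R A :=
  @Coefficients R A slice slice_tr _ _ _ _.
Next Obligation. by move=> m n s' s th e; exact: realize_continuous. Qed.
Next Obligation.
move=> l m n s'' s' s th ph ch e1 e2 e3 x chE; rewrite /slice_tr -realize_comp.
congr (realize _ x).
have ec : dom (slice_arrow s th) = cod (slice_arrow s' ph).
  by rewrite (slice_arrow_dom e2) slice_arrow_cod.
apply: (@over_push_comp B D Q _ _ _ _ _ _ _ _ _ _ _ _ ec).
have ea : dom (last_arrow th) = cod (fmor th (last_arrow ph)) by rewrite fcod.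
have es : dom (fmor s (last_arrow th)) = cod (fmor s (fmor th (last_arrow ph))).
  by rewrite fdom fcod ea.
have eP : dom (fmor P (fmor s (last_arrow th))) =
  cod (fmor P (fmor s (fmor th (last_arrow ph)))) by rewrite fdom fcod es.
transitivity (mcomp _ _ eP); last by apply: eq_comp => //; rewrite /slice_arrow e2.
rewrite -(fcomp es eP) -(fcomp ea es); congr (fmor P (fmor s _)).
apply: val_inj; rewrite /= chE /=; congr pair.
exact/esym/(fdom th (last_arrow ph)).
Qed.
Next Obligation.
move=> n s th e x thE; rewrite /slice_tr.
rewrite [slice_functor e]over_push_id ?realize_id //.
by apply: slice_arrow_id; rewrite thE.
Qed.
Next Obligation.
move=> m n s' s th sg e e' x thsg; rewrite /slice_tr -realize_comp.
have E : th (sg ord_max) = ord_max.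
  by rewrite -[LHS]/(functor_comp th sg ord_max) thsg.
have thm : th ord_max = ord_max.
  have : (th (sg ord_max) <= th ord_max)%N.
    by apply: ordcat_monotone; exact: leq_ord.
  by rewrite E => h; apply/val_inj/eqP; rewrite eqn_leq h leq_ord.
have Pe : P (s' ord_max) = P (s ord_max) by rewrite e /= thm.
have a1 : slice_arrow s th = idm (P (s' ord_max)).
  by rewrite Pe; exact: slice_arrow_id.
have a2 : slice_arrow s' sg = idm (P (s' ord_max)).
  rewrite /slice_arrow -!fidm; congr (fmor P _); rewrite e /=.
  congr (fmor s _); apply: eq_ord_mor; rewrite ?fdom ?fcod //= thm.
  exact: E.
have ee : dom (slice_arrow s' sg) = cod (slice_arrow s th).
  by rewrite a1 a2 dom_idm cod_idm.
rewrite (@over_push_comp B D Q _ _ (idm (P (s' ord_max))) _ _ _ _ _ _ _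
  (dom_idm _) (cod_idm _) ee).
  by rewrite over_push_id // realize_id.
have e1 : dom (idm (cod (idm (P (s' ord_max))))) = cod (idm (P (s' ord_max))).
  by rewrite dom_idm.
rewrite -[LHS](mcomp_idl e1); apply: eq_comp; rewrite ?a1 ?a2 //.
by rewrite cod_idm.
Qed.

End slices.

Section lift.
Variables (A D : category) (P : functor A D) (n : nat) (s : nerve A n).

Definition to_last (i : 'I_n.+1) : mor (ordcat n) :=
  @ord_arrow n i ord_max (leq_ord i).

(** The tautological lift of a simplex to the slice over its last vertex: each
    vertex comes with its arrow to the last one. *)
Program Definition slice_lift_ob (i : 'I_n.+1) : over_ob P (P (s ord_max)) :=
  @OverOb A D P _ (s i) (fmor P (fmor s (to_last i))) _ _.
Next Obligation. by move=> i; rewrite !fdom. Qed.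
Next Obligation. by move=> i; rewrite !fcod. Qed.

Program Definition slice_lift : nerve (overcat P (P (s ord_max))) n :=
  @Functor (ordcat n) (overcat P (P (s ord_max))) slice_lift_ob
    (fun f => @OverMor A D P _ (slice_lift_ob (dom f)) (slice_lift_ob (cod f))
      (fmor s f) (fdom s f) (fcod s f) _) _ _ _ _.
Next Obligation.
move=> f /=; have e0 : dom (to_last (cod f)) = cod f by [].
have e1 : dom (fmor s (to_last (cod f))) = cod (fmor s f) by rewrite fdom fcod.
have e2 : dom (fmor P (fmor s (to_last (cod f)))) = cod (fmor P (fmor s f)).
  by rewrite fdom fcod e1.
exists e2; rewrite -(fcomp e1 e2) -(fcomp e0 e1); congr (fmor P (fmor s _)).
exact: val_inj.
Qed.
Next Obligation. by []. Qed.
Next Obligation. by []. Qed.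
Next Obligation. by move=> i; apply: over_mor_eq => //=; rewrite fidm. Qed.
Next Obligation. by move=> g f e e'; apply: over_mor_eq => //=; exact: fcomp. Qed.

Lemma over_forget_lift : functor_comp (over_forget P _) slice_lift = s.
Proof. exact: eq_functor. Qed.

End lift.

Lemma slice_lift_comp (A D : category) (P : functor A D) m n
    (s' : nerve A m) (s : nerve A n) th (e : s' = functor_comp s th) :
  functor_comp (slice_functor P P e) (slice_lift P s') =
  functor_comp (slice_lift P s) th.
Proof.
have obE i : functor_comp (slice_functor P P e) (slice_lift P s') i =
    functor_comp (slice_lift P s) th i.
  apply: over_ob_eq => /=; first by rewrite e.
  have es : dom (last_arrow th) = cod (fmor th (to_last i)) by rewrite fcod.
  have e1 : dom (fmor s (last_arrow th)) = cod (fmor s (fmor th (to_last i))).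
    by rewrite fdom fcod es.
  have e2 : dom (fmor P (fmor s (last_arrow th))) =
    cod (fmor P (fmor s (fmor th (to_last i)))) by rewrite fdom fcod e1.
  transitivity (mcomp _ _ e2); first by apply: eq_comp => //; rewrite e.
  rewrite -(fcomp e1 e2) -(fcomp es e1); congr (fmor P (fmor s _)).
  by apply: val_inj; congr pair; exact: (fdom th (to_last i)).
apply: eq_functor => // f; apply: over_mor_eq.
- exact: etrans (fdom (functor_comp (slice_functor P P e) (slice_lift P s')) f)
    (etrans (obE _) (esym (fdom (functor_comp (slice_lift P s) th) f))).
- exact: etrans (fcod (functor_comp (slice_functor P P e) (slice_lift P s')) f)
    (etrans (obE _) (esym (fcod (functor_comp (slice_lift P s) th) f))).
- by rewrite /= e.
Qed.

(** * Quillen's theorem A for slices *)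

Section over_map.
Variables (C D : category) (F : functor C D) (d : ob D).

Definition over_map_ob (x : over_ob F d) : over_ob (functor_id D) d :=
  @OverOb D D (functor_id D) d (F (ov_ob x)) (ov_map x) (ov_dom x) (ov_cod x).

Program Definition over_map_mor (h : over_mor F d) : over_mor (functor_id D) d :=
  @OverMor D D (functor_id D) d (over_map_ob (ov_src h)) (over_map_ob (ov_tgt h))
    (fmor F (ov_mor h)) _ _ (ov_mor_eq h).
Next Obligation. by move=> h; rewrite fdom ov_mor_dom. Qed.
Next Obligation. by move=> h; rewrite fcod ov_mor_cod. Qed.

Program Definition over_map : functor (overcat F d) (overcat (functor_id D) d) :=
  @Functor (overcat F d) (overcat (functor_id D) d) over_map_ob over_map_mor
    (fun=> erefl) (fun=> erefl) _ _.
Next Obligation. by move=> x; apply: over_mor_eq => //=; rewrite fidm. Qed.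
Next Obligation. by move=> g h e e'; apply: over_mor_eq => //=; exact: fcomp. Qed.

Lemma over_forget_map :
  functor_comp (over_forget (functor_id D) d) over_map =
  functor_comp F (over_forget F d).
Proof. exact: eq_functor. Qed.

End over_map.

Lemma over_map_push (C D : category) (F : functor C D) (f : mor D) (d d' : ob D)
    (fd : dom f = d) (fc : cod f = d') :
  functor_comp (over_map F d') (over_push F fd fc) =
  functor_comp (over_push (functor_id D) fd fc) (over_map F d).
Proof.
have obE x : functor_comp (over_map F d') (over_push F fd fc) x =
    functor_comp (over_push (functor_id D) fd fc) (over_map F d) x.
  by apply: over_ob_eq => //=; exact: eq_comp.
by apply: eq_functor => // h; apply: over_mor_eq => //=; exact: obE.
Qed.

Lemma over_id_contractible (R : realType) (D : category) (d : ob D) :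
  contractible R (realization R (overcat (functor_id D) d)).
Proof.
pose top : ob (overcat (functor_id D) d) :=
  @OverOb D D (functor_id D) d d (idm d) (dom_idm d) (cod_idm d).
have bang_eq (x : over_ob (functor_id D) d) : exists e,
    mcomp (ov_map top) (fmor (functor_id D) (ov_map x)) e = ov_map x.
  have e : dom (idm d) = cod (ov_map x) by rewrite dom_idm ov_cod.
  have e' : dom (idm (cod (ov_map x))) = cod (ov_map x) by rewrite dom_idm.
  exists e; rewrite -[RHS](mcomp_idl e'); apply: eq_comp => //=.
  by rewrite ov_cod.
pose bang (x : ob (overcat (functor_id D) d)) : mor (overcat (functor_id D) d) :=
  @OverMor D D (functor_id D) d x top (ov_map x) (ov_dom x) (ov_cod x) (bang_eq x).
apply: (@terminal_contractible R _ top bang) => // f e.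
apply: over_mor_eq => //=; have [e1 <-] := ov_mor_eq f; exact: eq_comp.
Qed.

Section quillen.
Variables (R : realType) (C D : category) (F : functor C D).
Hypothesis F_initial : forall d, contractible R (realization R (overcat F d)).

(** The homotopies between the composites and the identities come from pairs of
    coherent maps with values in slices that are contractible: the inverse
    followed by the functor is compared with the tautological lift in the slices
    of the identity of D, and the other composite in the slices of F. *)
Theorem quillenA : homotopy_equivalence R (realize (R := R) F).
Proof.
pose E1 := slices R (functor_id D) F.
have cE1 n (s : nerve D n) : contractible R (E1 n s) by exact: F_initial.
have [a [ca aE]] := coherent_map_exists cE1.
have [||g cg gE] := @realization_map R D (realization R C)
    (fun n s t => realize (over_forget F _) (a n s t)).
- by move=> n s; exact: comp_continuous (ca n s) (@realize_continuous _ _ _ _).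
- move=> m n th s t; rewrite -(aE _ _ _ _ _ erefl) -realize_comp.
  by congr (realize _ _); exact/esym/over_forget_push.
split; first exact: realize_continuous.
exists g; split=> //.
- apply: (@homotopic_coherent R C (slices R F F) (fun n s => F_initial (F (s ord_max)))
    _ (fun n s => realize (over_forget F _)) (fun n s t => a n (functor_comp F s) t)
    (fun n s t => pt (slice_lift F s) t)).
  + by move=> n s; exact: realize_continuous.
  + move=> m n s' s th e x; rewrite -realize_comp.
    by congr (realize _ _); exact: over_forget_push.
  + split=> [n s|m n s' s th e t]; first exact: (ca n (functor_comp F s)).
    have e' : functor_comp F s' = functor_comp (functor_comp F s) th.
      by rewrite e functor_compA.
    rewrite -(aE _ _ _ _ _ e').
    congr (realize _ _); congr over_push; exact: Prop_irrelevance.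
  + split=> [n s|m n s' s th e t]; first exact: pt_continuous.
    by rewrite -pt_glue -(slice_lift_comp F e) -realize_pt.
  + by move=> n s t; rewrite /= realize_pt gE.
  + by move=> n s t; rewrite realize_pt over_forget_lift.
- apply: (@homotopic_coherent R D (slices R (functor_id D) (functor_id D))
    (fun n s => over_id_contractible R (s ord_max))
    _ (fun n s => realize (over_forget (functor_id D) _))
    (fun n s t => realize (over_map F _) (a n s t))
    (fun n s t => pt (slice_lift (functor_id D) s) t)).
  + by move=> n s; exact: realize_continuous.
  + move=> m n s' s th e x; rewrite -realize_comp.
    by congr (realize _ _); exact: over_forget_push.
  + split=> [n s|m n s' s th e t].
      exact: comp_continuous (ca n s) (@realize_continuous _ _ _ _).
    rewrite -(aE _ _ _ _ _ e) -[LHS]realize_comp -[RHS]realize_comp.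
    congr (realize _ _); exact/esym/over_map_push.
  + split=> [n s|m n s' s th e t]; first exact: pt_continuous.
    by rewrite -pt_glue -(slice_lift_comp (functor_id D) e) -realize_pt.
  + by move=> n s t; rewrite /= gE -!realize_comp over_forget_map.
  + by move=> n s t; rewrite realize_pt over_forget_lift.
Qed.

End quillen.

(** * Duality *)

Program Definition op (C : category) : category :=
  @Category (ob C) (mor C) (@cod C) (@dom C) (@idm C)
    (fun g f e => mcomp f g (esym e)) _ _ _ _ _ _ _.
Next Obligation. by move=> C x; rewrite cod_idm. Qed.
Next Obligation. by move=> C x; rewrite dom_idm. Qed.
Next Obligation. by move=> C g f e; rewrite cod_mcomp. Qed.
Next Obligation. by move=> C g f e; rewrite dom_mcomp. Qed.
Next Obligation. by move=> C f e /=; exact: mcomp_idr. Qed.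
Next Obligation. by move=> C f e /=; exact: mcomp_idl. Qed.
Next Obligation. by move=> C h g f e1 e2 e3 e4 /=; exact/esym/mcompA. Qed.

Program Definition op_functor (C D : category) (F : functor C D) :
    functor (op C) (op D) :=
  @Functor (op C) (op D) (fob F) (fmor F) (fcod F) (fdom F) (fidm F) _.
Next Obligation. by move=> C D F g f e e' /=; exact: fcomp. Qed.

Program Definition op_op (C : category) : functor (op (op C)) C :=
  @Functor (op (op C)) C id id (fun=> erefl) (fun=> erefl) (fun=> erefl) _.
Next Obligation. by move=> C g f e e'; exact: eq_comp. Qed.

Lemma rev_ord_monotone n (i j : 'I_n.+1) :
  (i <= j)%N -> (rev_ord j <= rev_ord i)%N.
Proof. by move=> ij /=; rewrite !subSS leq_sub2l. Qed.

Definition rev_mor n (f : mor (ordcat n)) : mor (ordcat n) :=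
  ord_arrow (rev_ord_monotone (valP f)).

Lemma dom_rev_mor n (f : mor (ordcat n)) : dom (rev_mor f) = rev_ord (cod f).
Proof. by []. Qed.

Lemma cod_rev_mor n (f : mor (ordcat n)) : cod (rev_mor f) = rev_ord (dom f).
Proof. by []. Qed.

Lemma rev_morK n : involutive (@rev_mor n).
Proof. by move=> f; apply: eq_ord_mor; rewrite /= rev_ordK. Qed.

Program Definition rev_simplex (C : category) n (s : nerve C n) :
    nerve (op C) n :=
  @Functor (ordcat n) (op C) (fun i => s (rev_ord i))
    (fun f => fmor s (rev_mor f)) _ _ _ _.
Next Obligation. by move=> C n s f; rewrite /= fcod. Qed.
Next Obligation. by move=> C n s f; rewrite /= fdom. Qed.
Next Obligation.
by move=> C n s i /=; rewrite -fidm; congr fmor; exact: val_inj.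
Qed.
Next Obligation.
move=> C n s g f e e' /=.
have e1 : dom (rev_mor f) = cod (rev_mor g).
  by rewrite dom_rev_mor cod_rev_mor e.
have e2 : dom (fmor s (rev_mor f)) = cod (fmor s (rev_mor g)).
  by rewrite fdom fcod e1.
transitivity (mcomp _ _ e2); last exact: eq_comp.
by rewrite -(fcomp e1 e2); congr fmor; exact: val_inj.
Qed.

Lemma rev_op_subproof m n (th : functor (ordcat m) (ordcat n)) (i j : 'I_m.+1) :
  (i <= j)%N -> (rev_ord (th (rev_ord i)) <= rev_ord (th (rev_ord j)))%N.
Proof.
by move=> ij; apply/rev_ord_monotone/ordcat_monotone/rev_ord_monotone.
Qed.

Definition rev_op m n (th : functor (ordcat m) (ordcat n)) :
    functor (ordcat m) (ordcat n) :=
  monotone (@rev_op_subproof m n th).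

Lemma rev_simplex_comp (C : category) m n (s : nerve C n)
    (th : functor (ordcat m) (ordcat n)) :
  rev_simplex (functor_comp s th) = functor_comp (rev_simplex s) (rev_op th).
Proof.
apply: eq_functor => [i|f] /=; first by rewrite rev_ordK.
congr fmor; apply: eq_ord_mor.
  by rewrite fdom /= rev_ordK.
by rewrite fcod /= rev_ordK.
Qed.

Section anti.
Variable (R : realType).

Lemma rev_pt_subproof n (t : std_simplex R n) :
  (\row_i coord t (rev_ord i)) \in std_simplex R n.
Proof.
apply/mem_set; split=> [i|]; first by rewrite mxE coord_ge0.
under eq_bigr do rewrite mxE.
by rewrite -[RHS](sum_coord t) [RHS](reindex_inj rev_ord_inj).
Qed.

Definition rev_pt n (t : std_simplex R n) : std_simplex R n :=
  exist (fun u => u \in std_simplex R n) _ (rev_pt_subproof t).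

Lemma coord_rev_pt n (t : std_simplex R n) i :
  coord (rev_pt t) i = coord t (rev_ord i).
Proof. by rewrite /coord mxE. Qed.

Lemma rev_ptK n (t : std_simplex R n) : rev_pt (rev_pt t) = t.
Proof. by apply: eq_simplex => i; rewrite !coord_rev_pt rev_ordK. Qed.

Lemma rev_pt_continuous n : continuous (@rev_pt n).
Proof.
move=> t; apply: simplex_continuous => i.
suff : continuous (fun t : std_simplex R n => coord t (rev_ord i)).
  move=> /(_ t); rewrite (_ : (fun _ => _) = (fun t => coord (rev_pt t) i)) //.
  by apply/funext => y; rewrite coord_rev_pt.
exact: coord_continuous.
Qed.

Lemma rev_pt_push m n (th : functor (ordcat m) (ordcat n)) (t : std_simplex R m) :
  push_simplex (rev_op th) (rev_pt t) = rev_pt (push_simplex th t).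
Proof.
apply: eq_simplex => j; rewrite coord_rev_pt !coord_push.
rewrite [RHS](reindex_inj rev_ord_inj); apply: eq_big => i.
  by rewrite -(inj_eq rev_ord_inj) /= rev_ordK.
by rewrite coord_rev_pt.
Qed.

(** Reversing the order of the vertices of all simplices. *)
Lemma anti_exists (C D : category) (U : functor (op C) D) :
  exists2 h : realization R C -> realization R D, continuous h &
    forall n (s : nerve C n) t,
      h (pt s t) = pt (functor_comp U (rev_simplex s)) (rev_pt t).
Proof.
apply: realization_map => [n s|m n th s t].
  exact: comp_continuous (@rev_pt_continuous n) (@pt_continuous _ _ _ _).
by rewrite rev_simplex_comp -functor_compA pt_glue rev_pt_push.
Qed.

Lemma op_homeo (C : category) :
  exists f : realization R (op C) -> realization R C,
  exists g : realization R C -> realization R (op C),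
  [/\ continuous f, continuous g, cancel f g, cancel g f &
    forall n (s : nerve (op C) n) t,
      f (pt s t) = pt (functor_comp (op_op C) (rev_simplex s)) (rev_pt t)].
Proof.
have [f cf fE] := anti_exists (op_op C).
have [g cg gE] := anti_exists (functor_id (op C)).
exists f, g; split=> //; apply: realization_ind => n s t.
- rewrite fE gE rev_ptK; congr pt; apply: eq_functor => [i|k] /=.
    by rewrite rev_ordK.
  by rewrite rev_morK.
- rewrite gE fE rev_ptK; congr pt; apply: eq_functor => [i|k] /=.
    by rewrite rev_ordK.
  by rewrite rev_morK.
Qed.

Section final.
Variables (C D : category) (F : functor C D).

Section under_over.
Variable d : ob D.

Definition over_of_under_ob (x : under_ob F d) : over_ob (op_functor F) d :=
  @OverOb (op C) (op D) (op_functor F) d (un_ob x) (un_map x) (un_cod x) (un_dom x).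

Definition under_of_over_ob (x : over_ob (op_functor F) d) : under_ob F d :=
  @UnderOb C D F d (ov_ob x) (ov_map x) (ov_cod x) (ov_dom x).

Program Definition over_of_under_mor (h : under_mor F d) :
    over_mor (op_functor F) d :=
  @OverMor (op C) (op D) (op_functor F) d (over_of_under_ob (un_tgt h))
    (over_of_under_ob (un_src h)) (un_mor h) (un_mor_cod h) (un_mor_dom h) _.
Next Obligation.
move=> h; have [e E] := un_mor_eq h; exists (esym e) => /=.
by rewrite -E; exact: eq_comp.
Qed.

Program Definition under_of_over_mor (h : over_mor (op_functor F) d) :
    under_mor F d :=
  @UnderMor C D F d (under_of_over_ob (ov_tgt h))
    (under_of_over_ob (ov_src h)) (ov_mor h) (ov_mor_cod h) (ov_mor_dom h) _.
Next Obligation.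
move=> h; have [e E] := ov_mor_eq h; exists (esym e) => /=.
by rewrite -E; exact: eq_comp.
Qed.

Program Definition over_of_under :
    functor (op (undercat F d)) (overcat (op_functor F) d) :=
  @Functor (op (undercat F d)) (overcat (op_functor F) d)
    over_of_under_ob over_of_under_mor (fun=> erefl) (fun=> erefl) _ _.
Next Obligation. by move=> x; apply: over_mor_eq. Qed.
Next Obligation. by move=> g f e e'; apply: over_mor_eq => //=; exact: eq_comp. Qed.

Program Definition under_of_over :
    functor (overcat (op_functor F) d) (op (undercat F d)) :=
  @Functor (overcat (op_functor F) d) (op (undercat F d))
    under_of_over_ob under_of_over_mor (fun=> erefl) (fun=> erefl) _ _.
Next Obligation. by move=> x; apply: under_mor_eq. Qed.
Next Obligation. by move=> g f e e'; apply: under_mor_eq => //=; exact: eq_comp. Qed.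

Lemma over_under_contractible :
  contractible R (realization R (undercat F d)) ->
  contractible R (realization R (overcat (op_functor F) d)).
Proof.
have [f [g [cf cg fK gK _]]] := op_homeo (undercat F d).
move=> /(contractible_retract cf cg fK).
apply: (@contractible_retract R _ _ (realize under_of_over) (realize over_of_under)).
- exact: realize_continuous.
- exact: realize_continuous.
move=> x; rewrite -realize_comp -[RHS]realize_id; congr (realize _ x).
have obE y : functor_comp over_of_under under_of_over y = y by exact: over_ob_eq.
by apply: eq_functor => // h; apply: over_mor_eq => //=; exact: obE.
Qed.

End under_over.

Theorem quillenA_final :
  (forall d, contractible R (realization R (undercat F d))) ->
  homotopy_equivalence R (realize (R := R) F).
Proof.
move=> F_final.
have Fop : homotopy_equivalence R (realize (R := R) (op_functor F)).
  by apply: quillenA => d; exact: over_under_contractible (F_final d).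
have [a [a' [ca ca' aK a'K aE]]] := op_homeo C.
have [b [b' [cb cb' bK b'K bE]]] := op_homeo D.
apply: (homotopy_equivalence_homeo ca ca' a'K aK cb cb' b'K bK _ Fop).
apply: realization_ind => n s t /=.
rewrite aE realize_pt realize_pt bE; congr pt.
exact: eq_functor.
Qed.

End final.
End anti.

(** * The step function of a point of a realization *)

Section steps.
Variable R : realType.

Definition below n (t : std_simplex R n) (i : 'I_n.+1) : R :=
  \sum_(k < n.+1 | (k < i)%N) coord t k.

Definition upto n (t : std_simplex R n) (i : 'I_n.+1) : R :=
  \sum_(k < n.+1 | (k <= i)%N) coord t k.

(** The step function of t takes the value i at u, where the unit interval is cut
    into consecutive intervals of lengths the coordinates of t. *)
Definition at_step n (t : std_simplex R n) (u : R) (i : 'I_n.+1) :=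
  below t i <= u < upto t i.

Lemma sum_coord_sub n (t : std_simplex R n) (P Q : pred 'I_n.+1) :
  (forall i, P i -> Q i) -> \sum_(i | P i) coord t i <= \sum_(i | Q i) coord t i.
Proof.
move=> PQ; rewrite big_mkcond [leRHS]big_mkcond; apply: ler_sum => i _.
case: ifP => [/PQ -> //|_]; case: ifP => // _; exact: coord_ge0.
Qed.

Lemma below_ge0 n (t : std_simplex R n) i : 0 <= below t i.
Proof. by apply: sumr_ge0 => k _; exact: coord_ge0. Qed.

Lemma upto_le1 n (t : std_simplex R n) i : upto t i <= 1.
Proof. by rewrite -(sum_coord t); exact: sum_coord_sub. Qed.

Lemma at_step_le n (t : std_simplex R n) u v i j :
  at_step t u i -> at_step t v j -> u <= v -> (i <= j)%N.
Proof.
move=> /andP[iu _] /andP[_ vj] uv; rewrite leqNgt; apply/negP => ji.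
have : upto t j <= below t i.
  by apply: sum_coord_sub => k kj; exact: leq_ltn_trans kj ji.
lra.
Qed.

Lemma at_step_unique n (t : std_simplex R n) u i j :
  at_step t u i -> at_step t u j -> i = j.
Proof.
move=> ui uj; apply/val_inj/eqP; rewrite eqn_leq.
by rewrite (at_step_le ui uj (lexx u)) (at_step_le uj ui (lexx u)).
Qed.

Lemma at_step_exists n (t : std_simplex R n) u :
  0 <= u -> u < 1 -> exists i, at_step t u i.
Proof.
move=> u0 u1; have P0 : u < upto t ord_max.
  rewrite (lt_le_trans u1) // -(sum_coord t); apply: sum_coord_sub => i _.
  exact: leq_ord.
case: (arg_minnP (P := fun i => u < upto t i) val P0) => i iu imin.
exists i; rewrite /at_step iu andbT leNgt; apply/negP => ui.
have [i0|i0] := posnP i.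
  move: ui; rewrite /below big_pred0 => [|k]; first by rewrite ltNge u0.
  by rewrite i0.
have ip : (i.-1 < n.+1)%N by rewrite prednK ?(ltn_ord i) // ltnW.
have E : upto t (Ordinal ip) = below t i.
  by apply: eq_bigl => k /=; rewrite -ltnS prednK.
have := imin (Ordinal ip); rewrite E => /(_ ui) /=.
by rewrite -ltnS prednK // ltnn.
Qed.

Lemma at_step_support n (t : std_simplex R n) i :
  coord t i != 0 -> at_step t (below t i) i.
Proof.
move=> ti; rewrite /at_step lexx /= /upto (bigD1 i) //= addrC.
rewrite (eq_bigl (fun k : 'I_n.+1 => (k < i)%N)) => [|k]; last first.
  by rewrite ltn_neqAle andbC.
by rewrite -/(below t i) ltrDl lt0r ti coord_ge0.
Qed.

Lemma sum_push m n (th : functor (ordcat m) (ordcat n)) (t : std_simplex R m)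
    (Q : pred 'I_n.+1) :
  \sum_(j | Q j) coord (push_simplex th t) j = \sum_(k | Q (th k)) coord t k.
Proof.
rewrite [RHS](partition_big th Q) //=; apply: eq_bigr => j Qj.
rewrite coord_push; apply: eq_bigl => k.
by apply/idP/andP => [/eqP ->|[]//]; rewrite Qj eqxx.
Qed.

(** As a monotone map preserves the order of the intervals, pushing forward the
    coordinates amounts to composing the step function with the map. *)
Lemma at_step_push m n (th : functor (ordcat m) (ordcat n))
    (t : std_simplex R m) u i :
  at_step t u i -> at_step (push_simplex th t) u (th i).
Proof.
move=> /andP[iu ui]; apply/andP; split.
  apply: le_trans iu; rewrite /below sum_push; apply: sum_coord_sub => k.
  by apply: contraTT; rewrite -!leqNgt; exact: ordcat_monotone.
apply: (lt_le_trans ui); rewrite /upto sum_push; apply: sum_coord_sub => k.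
exact: ordcat_monotone.
Qed.

Section step_arrow.
Variable C : category.

Definition step_arrow (x : prerealization R C) (u v : R) (f : mor C) :=
  u <= v /\ exists i j, [/\ at_step (projT2 x) u i, at_step (projT2 x) v j &
    f = fmor (projT2 (projT1 x)) (arrow i j)].

Lemma step_arrow_cell n (s : nerve C n) (t : std_simplex R n) u v i j :
  u <= v -> at_step t u i -> at_step t v j ->
  step_arrow (cell s t) u v (fmor s (arrow i j)).
Proof. by move=> uv ui vj; split=> //; exists i, j. Qed.

Lemma step_arrow_unique n (s : nerve C n) (t : std_simplex R n) u v i j f :
  at_step t u i -> at_step t v j -> step_arrow (cell s t) u v f ->
  f = fmor s (arrow i j).
Proof.
move=> ui vj [uv [i' [j' [/= ui' vj' ->]]]].
by rewrite (at_step_unique ui ui') (at_step_unique vj vj').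
Qed.

(** The cumulative sums of the barycentric coordinates turn a point into a
    step function with values in the category, on which the simplicial
    identifications act trivially. *)
Lemma step_arrow_glue x y : clos_refl_sym_trans _ (@glue R C) x y ->
  forall u v f, step_arrow x u v f <-> step_arrow y u v f.
Proof.
elim=> {x y} [_ _ [m n th s t]|//|x y _ IH|x y z _ IH1 _ IH2] u v f; last 2 first.
- exact: iff_sym.
- exact: iff_trans (IH1 u v f) (IH2 u v f).
split=> [] [uv [i [j [/= ui vj ->]]]].
  have ij := at_step_le ui vj uv.
  rewrite fmor_arrow //.
  by apply: step_arrow_cell => //; exact: at_step_push.
have in01 w k : at_step (push_simplex th t) w k -> 0 <= w /\ w < 1.
  move=> /andP[kw wk]; split; first exact: le_trans (below_ge0 _ _) kw.
  exact: lt_le_trans wk (upto_le1 _ _).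
have [u0 u1] := in01 _ _ ui; have [v0 v1] := in01 _ _ vj.
have [i' ui'] := at_step_exists t u0 u1.
have [j' vj'] := at_step_exists t v0 v1.
rewrite (at_step_unique ui (at_step_push th ui')).
rewrite (at_step_unique vj (at_step_push th vj')).
rewrite -fmor_arrow; last exact: (at_step_le ui' vj' uv).
exact: (@step_arrow_cell m (functor_comp s th)).
Qed.

End step_arrow.

Lemma support_retraction n (t : std_simplex R n) :
  exists e : functor (ordcat n) (ordcat n),
    (forall k : 'I_n.+1, coord t (e k) != 0) /\
    (forall k : 'I_n.+1, coord t k != 0 -> e k = k).
Proof.
have [a0 ta0] := simplex_support t.
have a0S : a0 \in [set k | coord t k != 0]%SET by rewrite finset.inE.
have [e [eS eid]] := retraction a0S; exists e; split=> k.
  by have := eS k; rewrite finset.inE.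
by move=> tk; apply: eid; rewrite finset.inE.
Qed.

End steps.

(** * Fixed points of a realization *)

Lemma eq_sig_val (T : Type) (P : T -> Prop) (x y : {x | P x}) :
  proj1_sig x = proj1_sig y -> x = y.
Proof.
by case: x y => [x px] [y py] /= e; subst y; congr exist; exact: Prop_irrelevance.
Qed.

Section fixed.
Variables (gT : finGroupType) (C : category) (a : cat_action gT C).
Variable (H : {group gT}).

Definition fixed_ob (x : ob C) := forall g, g \in H -> a g x = x.

Definition fixed_mor (f : mor C) := forall g, g \in H -> fmor (a g) f = f.

Lemma fixed_dom f : fixed_mor f -> fixed_ob (dom f).
Proof. by move=> fH g gH; rewrite -fdom fH. Qed.

Lemma fixed_cod f : fixed_mor f -> fixed_ob (cod f).
Proof. by move=> fH g gH; rewrite -fcod fH. Qed.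

Lemma fixed_idm x : fixed_ob x -> fixed_mor (idm x).
Proof. by move=> xH g gH; rewrite fidm xH. Qed.

Lemma fixed_mcomp g f e : fixed_mor g -> fixed_mor f -> fixed_mor (mcomp g f e).
Proof.
move=> gH fH k kH; have e' : dom (fmor (a k) g) = cod (fmor (a k) f).
  by rewrite fdom fcod e.
by rewrite (fcomp e e'); apply: eq_comp; [exact: gH|exact: fH].
Qed.

Program Definition fixcat : category :=
  @Category {x : ob C | fixed_ob x} {f : mor C | fixed_mor f}
    (fun f => exist _ (dom (proj1_sig f)) (fixed_dom (proj2_sig f)))
    (fun f => exist _ (cod (proj1_sig f)) (fixed_cod (proj2_sig f)))
    (fun x => exist _ (idm (proj1_sig x)) (fixed_idm (proj2_sig x)))
    (fun g f e => exist _ (mcomp (proj1_sig g) (proj1_sig f) (congr1 (@proj1_sig _ _) e))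
      (fixed_mcomp (congr1 (@proj1_sig _ _) e) (proj2_sig g) (proj2_sig f)))
    _ _ _ _ _ _ _.
Next Obligation. by move=> x; apply: eq_sig_val; exact: dom_idm. Qed.
Next Obligation. by move=> x; apply: eq_sig_val; exact: cod_idm. Qed.
Next Obligation. by move=> *; apply: eq_sig_val; exact: dom_mcomp. Qed.
Next Obligation. by move=> *; apply: eq_sig_val; exact: cod_mcomp. Qed.
Next Obligation. by move=> *; apply: eq_sig_val; exact: mcomp_idl. Qed.
Next Obligation. by move=> *; apply: eq_sig_val; exact: mcomp_idr. Qed.
Next Obligation. by move=> *; apply: eq_sig_val; exact: mcompA. Qed.

Program Definition fix_incl : functor fixcat C :=
  @Functor fixcat C (@proj1_sig _ _) (@proj1_sig _ _)
    (fun=> erefl) (fun=> erefl) (fun=> erefl) _.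
Next Obligation. by move=> g f e e'; exact: eq_comp. Qed.

Section lift.
Variables (K : category) (s : functor K C).
Hypothesis s_fixed : forall f, fixed_mor (fmor s f).

Lemma fix_lift_ob x : fixed_ob (s x).
Proof. by rewrite -[x]dom_idm -fdom; exact/fixed_dom/s_fixed. Qed.

Program Definition fix_lift : functor K fixcat :=
  @Functor K fixcat (fun x => exist _ (s x) (fix_lift_ob x))
    (fun f => exist _ (fmor s f) (s_fixed f)) _ _ _ _.
Next Obligation. by move=> f; apply: eq_sig_val; exact: fdom. Qed.
Next Obligation. by move=> f; apply: eq_sig_val; exact: fcod. Qed.
Next Obligation. by move=> f; apply: eq_sig_val; exact: fidm. Qed.
Next Obligation. by move=> *; apply: eq_sig_val; exact: fcomp. Qed.

Lemma fix_incl_lift : functor_comp fix_incl fix_lift = s.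
Proof. exact: eq_functor. Qed.

Lemma fix_liftE (s' : functor K fixcat) :
  functor_comp fix_incl s' = s -> fix_lift = s'.
Proof.
by move=> e; apply: eq_functor => [x|f]; apply: eq_sig_val; rewrite /= -e.
Qed.

End lift.

Section realized.
Variable R : realType.

Definition fixed_steps (x : prerealization R C) :=
  forall u v f, step_arrow x u v f -> fixed_mor f.

(** An element g of H maps the step function of the point to that of its
    translate, which is the same; so g fixes all the arrows it takes. *)
Lemma fixed_steps_fixed n (s : nerve C n) (t : std_simplex R n) :
  fixed_points (realize_action (R := R) a) H (pt s t) -> fixed_steps (cell s t).
Proof.
move=> sH u v f sf g gH; have [uv [i [j [/= ui vj fE]]]] := sf.
have := sH g gH; rewrite /realize_action realize_pt.
move=> /realization_eqP /step_arrow_glue.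
move=> /(_ u v (fmor (a g) f)) [+ _].
rewrite {1}fE => /(_ (step_arrow_cell (functor_comp (a g) s) uv ui vj)).
by move=> /(step_arrow_unique ui vj) ->.
Qed.

Lemma fixed_collapse n (s : nerve C n) (t : std_simplex R n)
    (e : functor (ordcat n) (ordcat n)) :
  (forall k : 'I_n.+1, coord t (e k) != 0) -> fixed_steps (cell s t) ->
  forall f, fixed_mor (fmor (functor_comp s e) f).
Proof.
move=> te sH f; have dc : (dom f <= cod f)%N := valP f.
have -> : f = arrow (dom f) (cod f).
  by apply: eq_ord_mor; rewrite ?dom_arrow ?cod_arrow.
rewrite /= fmor_arrow ?dom_arrow ?cod_arrow //.
have ec := ordcat_monotone e dc.
apply: (sH (below t (e (dom f))) (below t (e (cod f)))).
apply: step_arrow_cell; [|exact: at_step_support|exact: at_step_support].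
by apply: sum_coord_sub => k kd; exact: leq_trans kd ec.
Qed.

(** The retraction onto the support of a fixed point carries it to a simplex of
    the fixed category, whence a point [z] of the realization of this category.
    As it is compatible with the gluing, [z] depends only on the class of [x]:
    this is the inverse of the inclusion on fixed points. *)
Definition fix_value (x : prerealization R C) (z : realization R fixcat) :=
  fixed_steps x /\
  exists (e : functor (ordcat _) (ordcat _))
    (eH : forall f, fixed_mor (fmor (functor_comp (projT2 (projT1 x)) e) f)),
  [/\ forall k, coord (projT2 x) (e k) != 0,
      forall k, coord (projT2 x) k != 0 -> e k = k &
      z = pt (fix_lift eH) (projT2 x)].

Lemma fix_value_exists x : fixed_steps x -> exists z, fix_value x z.
Proof.
case: x => -[n s] t sH; have [e [te eid]] := support_retraction t.
have eH := fixed_collapse te sH.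
by exists (pt (fix_lift eH) t); split=> //; exists e, eH.
Qed.

Lemma fix_value_glue_eq m n (th : functor (ordcat m) (ordcat n)) (s : nerve C n)
    (t : std_simplex R m) z z' :
  fix_value (cell (functor_comp s th) t) z ->
  fix_value (cell s (push_simplex th t)) z' -> z = z'.
Proof.
move=> [_ [e [eH [/= te eid ->]]]] [_ [e' [eH' [/= te' eid' ->]]]].
have E : functor_comp e' (functor_comp th e) = functor_comp th e.
  apply: eq_ord_functor => k /=; apply: eid'; rewrite coord_push.
  rewrite (bigD1 (e k)) //=; apply: lt0r_neq0.
  rewrite ltr_wpDr ?sumr_ge0 // => [i _|]; first exact: coord_ge0.
  by rewrite lt0r te coord_ge0.
have -> : fix_lift eH = functor_comp (fix_lift eH') (functor_comp th e).
  apply: fix_liftE; rewrite -functor_compA fix_incl_lift.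
  by rewrite functor_compA E functor_compA.
by rewrite pt_glue push_comp [push_simplex e t]push_fix.
Qed.

Lemma fix_value_unique x z z' : fix_value x z -> fix_value x z' -> z = z'.
Proof.
case: x => -[n s] t vz vz'; apply: (@fix_value_glue_eq n n (functor_id _) s t).
  by rewrite functor_comp_idr.
by rewrite push_id.
Qed.

Lemma fix_value_glue x y z : clos_refl_sym_trans _ (@glue R C) x y ->
  fix_value x z <-> fix_value y z.
Proof.
elim=> {x y} [_ _ [m n th s t]|//|x y _ IH|x y w _ IH1 _ IH2]; last 2 first.
- exact: iff_sym.
- exact: iff_trans IH1 IH2.
have FE u v f := step_arrow_glue (rst_step _ _ _ _ (Glue th s t)) u v f.
split=> vz; have [vH _] := vz.
  have [|z' vz'] := @fix_value_exists (cell s (push_simplex th t)).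
    by move=> u v f /FE; exact: vH.
  by rewrite (fix_value_glue_eq vz vz').
have [|z' vz'] := @fix_value_exists (cell (functor_comp s th) t).
  by move=> u v f /FE; exact: vH.
by rewrite -(fix_value_glue_eq vz' vz).
Qed.

Lemma fix_value_incl n (s : nerve fixcat n) (t : std_simplex R n) :
  fix_value (cell (functor_comp fix_incl s) t) (pt s t).
Proof.
have sH : fixed_steps (cell (functor_comp fix_incl s) t).
  by move=> u v f [_ [i [j [_ _ ->]]]]; exact: (proj2_sig (fmor s (arrow i j))).
split=> //; have [e [te eid]] := support_retraction t.
exists e, (fixed_collapse te sH); split=> //.
rewrite (@fix_liftE _ _ _ (functor_comp s e)); last by rewrite functor_compA.
by rewrite pt_glue push_fix.
Qed.

Lemma realize_fix_incl_inj : injective (realize (R := R) fix_incl).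
Proof.
apply: realization_ind => n s t; apply: realization_ind => m s' t'.
rewrite !realize_pt => /realization_eqP st.
by apply: fix_value_unique (fix_value_incl s' t'); apply/(fix_value_glue _ st);
  exact: fix_value_incl.
Qed.

Lemma realize_fix_incl_fixed x :
  fixed_points (realize_action (R := R) a) H (realize fix_incl x).
Proof.
move=> g gH; rewrite /realize_action -realize_comp; congr (realize _ x).
by apply: eq_functor => y; exact: (proj2_sig y).
Qed.

Lemma fix_value_realize n (s : nerve C n) (t : std_simplex R n) z :
  fix_value (cell s t) z -> realize fix_incl z = pt s t.
Proof.
move=> [_ [e [eH [/= te eid ->]]]].
by rewrite realize_pt fix_incl_lift pt_glue push_fix.
Qed.

Lemma realize_fix_incl_surj y : fixed_points (realize_action (R := R) a) H y ->
  exists x, realize fix_incl x = y.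
Proof.
move: y; apply: realization_ind => n s t /fixed_steps_fixed /fix_value_exists[z].
by move=> /fix_value_realize; exists z.
Qed.

Lemma closed_realization (A : category) (B : set (realization R A)) :
  (forall n (s : nerve A n), closed [set t | B (pt s t)]) -> closed B.
Proof.
move=> cB; rewrite -openC.
apply/(sigT_openP (_ : set (prerealization R A))) => -[n s].
exact: (closed_openC (cB n s)).
Qed.

(** On each simplex, the fixed points form a union of faces, indexed by the
    possible supports; on each of these faces the inverse of the inclusion is
    the characteristic map of a simplex of the fixed category. *)
Lemma realize_fix_incl_closed (A : set (realization R fixcat)) :
  closed A -> closed (realize (R := R) fix_incl @` A).
Proof.
move=> cA; apply: closed_realization => n s.
have [e eP] : {e : {set 'I_n.+1} -> functor (ordcat n) (ordcat n) &
    forall (S : {set 'I_n.+1}) a0, a0 \in S -> (forall k : 'I_n.+1, e S k \in S) /\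
      (forall k : 'I_n.+1, k \in S -> e S k = k)}.
  apply: (@choice _ _ (fun (S : {set 'I_n.+1}) (e : functor (ordcat n) (ordcat n)) =>
    forall a0, a0 \in S -> (forall k : 'I_n.+1, e k \in S) /\
      (forall k : 'I_n.+1, k \in S -> e k = k))) => S.
  have [[a0 a0S]|nS] := pselect (exists a0, a0 \in S).
    by have [e he] := retraction a0S; exists e.
  by exists (functor_id _) => a0 a0S; case: nS; exists a0.
pose face_fixed (S : {set 'I_n.+1}) := forall f, fixed_mor (fmor (functor_comp s (e S)) f).
pose piece (S : {set 'I_n.+1}) := [set t : std_simplex R n |
  (forall i, i \notin S -> coord t i = 0) /\
  exists eH : face_fixed S, A (pt (fix_lift eH) t)].
suff -> : [set t | (realize (R := R) fix_incl @` A) (pt s t)] =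
    \bigcup_(S in [set: {set 'I_n.+1}]) piece S.
  apply: closed_bigcup => [|S _]; first exact: finite_finset.
  have -> : piece S =
      \bigcap_i [set t | i \notin S -> coord t i = 0] `&`
      [set t | exists eH : face_fixed S, A (pt (fix_lift eH) t)].
    apply/seteqP; split=> t [tS tA]; split=> //.
      by move=> i _; exact: tS.
    by move=> i; exact: (tS i I).
  apply: closedI.
    apply: closed_bigI => i _; case: (boolP (i \in S)) => iS.
      suff -> : [set t : std_simplex R n | ~~ true -> coord t i = 0] = setT.
        exact: closedT.
      by apply/seteqP.
    suff -> : [set t : std_simplex R n | ~~ false -> coord t i = 0] =
        (fun t : std_simplex R n => coord t i) @^-1` [set 0].
      apply: preimage_closed => [t _|]; first exact: coord_continuous.
      exact: closed_eq.
    by apply/seteqP; split=> t /=; [exact|].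
  have [eH|nH] := pselect (face_fixed S); last first.
    suff -> : [set t | exists eH : face_fixed S, A (pt (fix_lift eH) t)] = set0.
      exact: closed0.
    by apply/seteqP; split=> t // [].
  suff -> : [set t | exists eH : face_fixed S, A (pt (fix_lift eH) t)] =
      pt (fix_lift eH) @^-1` A.
    by apply: preimage_closed => // t _; exact: pt_continuous.
  apply/seteqP; split=> t /= => [[eH'] |At]; last by exists eH.
  by rewrite (Prop_irrelevance eH' eH).
apply/seteqP; split=> t.
- move=> [z Az zE]; pose S := [set k | coord t k != 0]%SET.
  exists S => //; split=> [i|]; first by rewrite finset.inE negbK => /eqP.
  have [a0 ta0] := simplex_support t.
  have [|eS eid] := eP S a0; first by rewrite finset.inE.
  have te k : coord t (e S k) != 0 by have := eS k; rewrite finset.inE.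
  have tH : fixed_steps (cell s t).
    by apply: fixed_steps_fixed; rewrite -zE; exact: realize_fix_incl_fixed.
  exists (fixed_collapse te tH).
  suff -> : pt (fix_lift (fixed_collapse te tH)) t = z by [].
  apply: realize_fix_incl_inj; rewrite zE; apply: fix_value_realize.
  split=> //; exists (e S), (fixed_collapse te tH); split=> // k tk.
  by apply: eid; rewrite finset.inE.
- move=> [S _ [tS [eH Az]]]; exists (pt (fix_lift eH) t) => //.
  have supp k : coord t k != 0 -> k \in S.
    by apply: contra_neqT => /tS.
  have [a0 /supp a0S] := simplex_support t.
  rewrite realize_pt fix_incl_lift pt_glue push_fix // => k /supp.
  exact: (eP S a0 a0S).2.
Qed.

(** The inclusion of the fixed category induces a closed continuous bijection
    onto the fixed points. *)
Theorem fixed_points_homeo :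
  exists f : realization R fixcat -> fixed_points (realize_action (R := R) a) H,
  exists g : fixed_points (realize_action (R := R) a) H -> realization R fixcat,
  [/\ continuous f, continuous g, cancel f g, cancel g f &
    forall x, val (f x) = realize fix_incl x].
Proof.
pose fP x : realize (R := R) fix_incl x \in
  fixed_points (realize_action (R := R) a) H :=
  mem_set (realize_fix_incl_fixed x).
pose f x : fixed_points (realize_action (R := R) a) H :=
  exist (fun y => y \in fixed_points (realize_action (R := R) a) H) _ (fP x).
have gP (y : fixed_points (realize_action (R := R) a) H) :
    exists x, realize fix_incl x = val y.
  by apply: realize_fix_incl_surj; exact: set_mem (valP y).
have [g gE] := choice gP.
have gK : cancel g f by move=> y; apply: val_inj; exact: gE.
have fK : cancel f g.
  by move=> x; apply: realize_fix_incl_inj; rewrite gE.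
exists f, g; split=> //.
- by apply: continuous_comp_initial; exact: realize_continuous.
- apply/continuous_closedP => A cA.
  have -> : g @^-1` A = val @^-1` (realize (R := R) fix_incl @` A).
    apply/seteqP; split=> y /= => [Ay|[x Ax xE]]; first by exists (g y).
    suff -> : g y = x by [].
    by apply: realize_fix_incl_inj; rewrite gE.
  apply: preimage_closed; last exact: realize_fix_incl_closed.
  by move=> y _; exact: initial_continuous.
Qed.

End realized.
End fixed.

(** * Slices of the functor between fixed categories *)

Section equivariant.
Variables (R : realType) (gT : finGroupType) (C D : category).
Variables (aC : cat_action gT C) (aD : cat_action gT D) (F : functor C D).
Hypothesis hF : is_Gfunctor aC aD F.
Variable H : {group gT}.

Lemma fix_functor_ob x : fixed_ob aC H x -> fixed_ob aD H (F x).
Proof. by move=> xH g gH; rewrite -(proj1 hF) xH. Qed.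

Lemma fix_functor_mor f : fixed_mor aC H f -> fixed_mor aD H (fmor F f).
Proof. by move=> fH g gH; rewrite -(proj2 hF) fH. Qed.

Program Definition fix_functor : functor (fixcat aC H) (fixcat aD H) :=
  @Functor (fixcat aC H) (fixcat aD H)
    (fun x => exist _ (F (proj1_sig x)) (fix_functor_ob (proj2_sig x)))
    (fun f => exist _ (fmor F (proj1_sig f)) (fix_functor_mor (proj2_sig f)))
    _ _ _ _.
Next Obligation. by move=> f; apply: eq_sig_val; exact: fdom. Qed.
Next Obligation. by move=> f; apply: eq_sig_val; exact: fcod. Qed.
Next Obligation. by move=> f; apply: eq_sig_val; exact: fidm. Qed.
Next Obligation. by move=> *; apply: eq_sig_val; exact: fcomp. Qed.

Section slice.
Variable d : ob (fixcat aD H).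
Let d0 : ob D := proj1_sig d.

(** The group H, which fixes d, seen as a subgroup of the stabilizer of d. *)
Definition slice_group : {group subg_of (stab aD d0)} := (sgval @*^-1 H)%G.

Lemma slice_groupP k : k \in slice_group -> sgval k \in H.
Proof. by move=> /morphpreP[]. Qed.

Lemma slice_group_lift g : g \in H -> exists2 k, k \in slice_group & sgval k = g.
Proof.
move=> gH; have gs : g \in stab aD d0.
  by apply/stab_setP; exact: (proj2_sig d).
exists (subg (stab aD d0) g); last exact: subgK.
by apply/morphpreP; split; [exact: finset.in_setT|rewrite /= subgK].
Qed.

Program Definition over_unfix_ob (x : over_ob fix_functor d) : over_ob F d0 :=
  @OverOb C D F d0 (proj1_sig (ov_ob x)) (proj1_sig (ov_map x)) _ _.
Next Obligation. by move=> x; exact: (congr1 (@proj1_sig _ _) (ov_dom x)). Qed.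
Next Obligation. by move=> x; exact: (congr1 (@proj1_sig _ _) (ov_cod x)). Qed.

Program Definition over_unfix_mor (h : over_mor fix_functor d) : over_mor F d0 :=
  @OverMor C D F d0 (over_unfix_ob (ov_src h)) (over_unfix_ob (ov_tgt h))
    (proj1_sig (ov_mor h)) _ _ _.
Next Obligation. by move=> h; exact: (congr1 (@proj1_sig _ _) (ov_mor_dom h)). Qed.
Next Obligation. by move=> h; exact: (congr1 (@proj1_sig _ _) (ov_mor_cod h)). Qed.
Next Obligation.
move=> h; have [e E] := ov_mor_eq h.
exists (congr1 (@proj1_sig _ _) e) => /=.
by rewrite -(congr1 (@proj1_sig _ _) E); exact: eq_comp.
Qed.

Lemma over_unfix_ob_fixed x : fixed_ob (over_action hF d0) slice_group (over_unfix_ob x).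
Proof.
move=> k /slice_groupP kH; apply: over_ob_eq => /=.
  exact: (proj2_sig (ov_ob x)).
exact: (proj2_sig (ov_map x)).
Qed.

Lemma over_unfix_mor_fixed h : fixed_mor (over_action hF d0) slice_group (over_unfix_mor h).
Proof.
move=> k kH; apply: over_mor_eq => /=.
- exact: (over_unfix_ob_fixed (ov_src h) kH).
- exact: (over_unfix_ob_fixed (ov_tgt h) kH).
- exact: (proj2_sig (ov_mor h) _ (slice_groupP kH)).
Qed.

Program Definition over_unfix :
    functor (overcat fix_functor d) (fixcat (over_action hF d0) slice_group) :=
  @Functor (overcat fix_functor d) (fixcat (over_action hF d0) slice_group)
    (fun x => exist _ (over_unfix_ob x) (@over_unfix_ob_fixed x))
    (fun h => exist _ (over_unfix_mor h) (@over_unfix_mor_fixed h)) _ _ _ _.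
Next Obligation. by move=> h; exact: eq_sig_val. Qed.
Next Obligation. by move=> h; exact: eq_sig_val. Qed.
Next Obligation. by move=> x; apply: eq_sig_val; exact: over_mor_eq. Qed.
Next Obligation.
move=> g h e e'; apply: eq_sig_val; apply: over_mor_eq => //=; exact: eq_comp.
Qed.

Program Definition over_fix_ob (x : ob (fixcat (over_action hF d0) slice_group)) :
    over_ob fix_functor d :=
  @OverOb (fixcat aC H) (fixcat aD H) fix_functor d
    (exist _ (ov_ob (proj1_sig x)) _) (exist _ (ov_map (proj1_sig x)) _) _ _.
Next Obligation.
move=> [x xH] g /slice_group_lift[k kH <-].
exact: (congr1 (@ov_ob _ _ _ _) (xH k kH)).
Qed.
Next Obligation.
move=> [x xH] g /slice_group_lift[k kH <-].
exact: (congr1 (@ov_map _ _ _ _) (xH k kH)).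
Qed.
Next Obligation. by move=> x; apply: eq_sig_val; exact: ov_dom. Qed.
Next Obligation. by move=> x; apply: eq_sig_val; exact: ov_cod. Qed.

Program Definition over_fix_mor (h : mor (fixcat (over_action hF d0) slice_group)) :
    over_mor fix_functor d :=
  @OverMor (fixcat aC H) (fixcat aD H) fix_functor d
    (over_fix_ob (dom h)) (over_fix_ob (cod h))
    (exist _ (ov_mor (proj1_sig h)) _) _ _ _.
Next Obligation.
move=> [h hH] g /slice_group_lift[k kH <-].
exact: (congr1 (@ov_mor _ _ _ _) (hH k kH)).
Qed.
Next Obligation. by move=> h; apply: eq_sig_val; exact: ov_mor_dom. Qed.
Next Obligation. by move=> h; apply: eq_sig_val; exact: ov_mor_cod. Qed.
Next Obligation.
move=> h; have [e E] := ov_mor_eq (proj1_sig h).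
have e' : dom (ov_map (over_fix_ob (cod h))) =
  cod (fmor fix_functor (exist _ (ov_mor (proj1_sig h)) (over_fix_mor_obligation_1 h))).
  exact: eq_sig_val.
exists e'; apply: eq_sig_val => /=; rewrite -E; exact: eq_comp.
Qed.

Program Definition over_fix :
    functor (fixcat (over_action hF d0) slice_group) (overcat fix_functor d) :=
  @Functor (fixcat (over_action hF d0) slice_group) (overcat fix_functor d)
    over_fix_ob over_fix_mor (fun=> erefl) (fun=> erefl) _ _.
Next Obligation.
move=> x; apply: over_mor_eq => /=.
- by congr over_fix_ob; exact: eq_sig_val.
- by congr over_fix_ob; exact: eq_sig_val.
- exact: eq_sig_val.
Qed.
Next Obligation.
move=> g h e e'; apply: over_mor_eq => /=.
- by congr over_fix_ob; exact: eq_sig_val.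
- by congr over_fix_ob; exact: eq_sig_val.
- by apply: eq_sig_val; exact: eq_comp.
Qed.

(** The slice over d of the functor between the fixed categories is a retract of
    the fixed category of the slice of F, whose realization is a space of fixed
    points of the slice. *)
Lemma over_fix_contractible :
  G_contractible R (over_action hF d0) ->
  contractible R (realization R (overcat fix_functor d)).
Proof.
move=> /(_ slice_group).
have [f [g [cf cg fK _ _]]] :=
  fixed_points_homeo (over_action hF d0) slice_group R.
move=> /(contractible_retract cf cg fK).
apply: (@contractible_retract R _ _ (realize over_unfix) (realize over_fix)).
- exact: realize_continuous.
- exact: realize_continuous.
move=> x; rewrite -realize_comp -[RHS]realize_id; congr (realize _ x).
have obE y : functor_comp over_fix over_unfix y = y.
  by apply: over_ob_eq; exact: eq_sig_val.
apply: eq_functor => // h; apply: over_mor_eq; last exact: eq_sig_val.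
- by rewrite /= -[RHS]obE; congr over_fix_ob; exact: eq_sig_val.
- by rewrite /= -[RHS]obE; congr over_fix_ob; exact: eq_sig_val.
Qed.

Program Definition under_unfix_ob (x : under_ob fix_functor d) : under_ob F d0 :=
  @UnderOb C D F d0 (proj1_sig (un_ob x)) (proj1_sig (un_map x)) _ _.
Next Obligation. by move=> x; exact: (congr1 (@proj1_sig _ _) (un_dom x)). Qed.
Next Obligation. by move=> x; exact: (congr1 (@proj1_sig _ _) (un_cod x)). Qed.

Program Definition under_unfix_mor (h : under_mor fix_functor d) : under_mor F d0 :=
  @UnderMor C D F d0 (under_unfix_ob (un_src h)) (under_unfix_ob (un_tgt h))
    (proj1_sig (un_mor h)) _ _ _.
Next Obligation. by move=> h; exact: (congr1 (@proj1_sig _ _) (un_mor_dom h)). Qed.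
Next Obligation. by move=> h; exact: (congr1 (@proj1_sig _ _) (un_mor_cod h)). Qed.
Next Obligation.
move=> h; have [e E] := un_mor_eq h.
exists (congr1 (@proj1_sig _ _) e) => /=.
by rewrite -(congr1 (@proj1_sig _ _) E); exact: eq_comp.
Qed.

Lemma under_unfix_ob_fixed x : fixed_ob (under_action hF d0) slice_group (under_unfix_ob x).
Proof.
move=> k /slice_groupP kH; apply: under_ob_eq => /=.
  exact: (proj2_sig (un_ob x)).
exact: (proj2_sig (un_map x)).
Qed.

Lemma under_unfix_mor_fixed h : fixed_mor (under_action hF d0) slice_group (under_unfix_mor h).
Proof.
move=> k kH; apply: under_mor_eq => /=.
- exact: (under_unfix_ob_fixed (un_src h) kH).
- exact: (under_unfix_ob_fixed (un_tgt h) kH).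
- exact: (proj2_sig (un_mor h) _ (slice_groupP kH)).
Qed.

Program Definition under_unfix :
    functor (undercat fix_functor d) (fixcat (under_action hF d0) slice_group) :=
  @Functor (undercat fix_functor d) (fixcat (under_action hF d0) slice_group)
    (fun x => exist _ (under_unfix_ob x) (@under_unfix_ob_fixed x))
    (fun h => exist _ (under_unfix_mor h) (@under_unfix_mor_fixed h)) _ _ _ _.
Next Obligation. by move=> h; exact: eq_sig_val. Qed.
Next Obligation. by move=> h; exact: eq_sig_val. Qed.
Next Obligation. by move=> x; apply: eq_sig_val; exact: under_mor_eq. Qed.
Next Obligation.
move=> g h e e'; apply: eq_sig_val; apply: under_mor_eq => //=; exact: eq_comp.
Qed.

Program Definition under_fix_ob (x : ob (fixcat (under_action hF d0) slice_group)) :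
    under_ob fix_functor d :=
  @UnderOb (fixcat aC H) (fixcat aD H) fix_functor d
    (exist _ (un_ob (proj1_sig x)) _) (exist _ (un_map (proj1_sig x)) _) _ _.
Next Obligation.
move=> [x xH] g /slice_group_lift[k kH <-].
exact: (congr1 (@un_ob _ _ _ _) (xH k kH)).
Qed.
Next Obligation.
move=> [x xH] g /slice_group_lift[k kH <-].
exact: (congr1 (@un_map _ _ _ _) (xH k kH)).
Qed.
Next Obligation. by move=> x; apply: eq_sig_val; exact: un_dom. Qed.
Next Obligation. by move=> x; apply: eq_sig_val; exact: un_cod. Qed.

Program Definition under_fix_mor (h : mor (fixcat (under_action hF d0) slice_group)) :
    under_mor fix_functor d :=
  @UnderMor (fixcat aC H) (fixcat aD H) fix_functor d
    (under_fix_ob (dom h)) (under_fix_ob (cod h))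
    (exist _ (un_mor (proj1_sig h)) _) _ _ _.
Next Obligation.
move=> [h hH] g /slice_group_lift[k kH <-].
exact: (congr1 (@un_mor _ _ _ _) (hH k kH)).
Qed.
Next Obligation. by move=> h; apply: eq_sig_val; exact: un_mor_dom. Qed.
Next Obligation. by move=> h; apply: eq_sig_val; exact: un_mor_cod. Qed.
Next Obligation.
move=> h; have [e E] := un_mor_eq (proj1_sig h).
have e' : dom (fmor fix_functor
    (exist _ (un_mor (proj1_sig h)) (under_fix_mor_obligation_1 h))) =
  cod (un_map (under_fix_ob (dom h))).
  exact: eq_sig_val.
exists e'; apply: eq_sig_val => /=; rewrite -E; exact: eq_comp.
Qed.

Program Definition under_fix :
    functor (fixcat (under_action hF d0) slice_group) (undercat fix_functor d) :=
  @Functor (fixcat (under_action hF d0) slice_group) (undercat fix_functor d)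
    under_fix_ob under_fix_mor (fun=> erefl) (fun=> erefl) _ _.
Next Obligation.
move=> x; apply: under_mor_eq => /=.
- by congr under_fix_ob; exact: eq_sig_val.
- by congr under_fix_ob; exact: eq_sig_val.
- exact: eq_sig_val.
Qed.
Next Obligation.
move=> g h e e'; apply: under_mor_eq => /=.
- by congr under_fix_ob; exact: eq_sig_val.
- by congr under_fix_ob; exact: eq_sig_val.
- by apply: eq_sig_val; exact: eq_comp.
Qed.

Lemma under_fix_contractible :
  G_contractible R (under_action hF d0) ->
  contractible R (realization R (undercat fix_functor d)).
Proof.
move=> /(_ slice_group).
have [f [g [cf cg fK _ _]]] :=
  fixed_points_homeo (under_action hF d0) slice_group R.
move=> /(contractible_retract cf cg fK).
apply: (@contractible_retract R _ _ (realize under_unfix) (realize under_fix)).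
- exact: realize_continuous.
- exact: realize_continuous.
move=> x; rewrite -realize_comp -[RHS]realize_id; congr (realize _ x).
have obE y : functor_comp under_fix under_unfix y = y.
  by apply: under_ob_eq; exact: eq_sig_val.
apply: eq_functor => // h; apply: under_mor_eq; last exact: eq_sig_val.
- by rewrite /= -[RHS]obE; congr under_fix_ob; exact: eq_sig_val.
- by rewrite /= -[RHS]obE; congr under_fix_ob; exact: eq_sig_val.
Qed.

End slice.

Lemma fixed_map_equivalence
    (ef : equivariant (realize_action (R := R) aC) (realize_action (R := R) aD)
      (realize (R := R) F)) :
  homotopy_equivalence R (realize (R := R) fix_functor) ->
  homotopy_equivalence R (fixed_map ef (H := H)).
Proof.
have [f [f' [cf cf' fK f'K fE]]] := fixed_points_homeo aC H R.
have [g [g' [cg cg' gK g'K gE]]] := fixed_points_homeo aD H R.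
apply: (homotopy_equivalence_homeo cf cf' f'K fK cg cg' g'K gK) => x.
apply: val_inj; rewrite /= gE; transitivity (realize F (val (f x))) => //.
rewrite fE -!realize_comp; congr (realize _ x); exact: eq_functor.
Qed.

End equivariant.

(** * The equivariant theorem *)

Theorem theoremA3 (R : realType) (gT : finGroupType) (C D : category)
    (aC : cat_action gT C) (aD : cat_action gT D)
    (F : functor C D) (hF : is_Gfunctor aC aD F) :
  G_homotopy_initial R hF \/ G_homotopy_final R hF ->
  G_homotopy_equivalence R (realize_action (R := R) aC)
    (realize_action (R := R) aD) (realize (R := R) F).
Proof.
move=> F_contractible; split; first exact: realize_continuous.
have ef : equivariant (realize_action (R := R) aC) (realize_action (R := R) aD)
    (realize (R := R) F).
  move=> g x; rewrite /realize_action -!realize_comp; congr (realize _ x).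
  by apply: eq_functor => y; apply hF.
exists ef => H; apply: (@fixed_map_equivalence R gT C D aC aD F hF H ef).
case: F_contractible => F_contractible.
  by apply: quillenA => d; apply: over_fix_contractible.
by apply: quillenA_final => d; apply: under_fix_contractible.
Qed.
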